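(* Let $K$ be a compact subgroup of $\mathrm{O}(n)$ acting naturally on $\mathbb{R}^n$, and let $\{\rho_1,\dots,\rho_\ell\}$ be a set of generators of the algebra $\mathcal{P}(\mathbb{R}^n)^K$ of $K$-invariant polynomials; write $\rho=(\rho_1,\dots,\rho_\ell):\mathbb{R}^n\to\mathbb{R}^\ell$. For $\xi\in\mathbb{R}^n$ let $\varphi_\xi(x)=\int_K e^{i\langle x,k\cdot\xi\rangle}\,dk$. There is a family $\{h_\xi\}_{\xi\in\mathbb{R}^n}$ of real analytic functions $h_\xi:\mathbb{R}^\ell\to\mathbb{C}$ with $\varphi_\xi(x)=h_\xi(\rho(x))$ for all $x,\xi\in\mathbb{R}^n$, such that for every $K$-invariant $g\in C^\infty(\mathbb{R}^n)$ (complex-valued) with compact support, the function $$h(t)=\int_{\mathbb{R}^n}g(-\xi)\,h_\xi(t)\,d\xi\qquad(t\in\mathbb{R}^\ell)$$ is well defined, $h\in C^\infty(\mathbb{R}^\ell)$, and $\mathcal{F}(g)(\varphi_\xi)=h(\rho(\xi))$ for every $\xi\in\mathbb{R}^n$.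
   Context: $dk$ is the normalized Haar measure on $K$; $dx$ and $d\xi$ denote Lebesgue measure on $\mathbb{R}^n$. $\mathcal{P}(\mathbb{R}^n)^K$ is the (finitely generated) algebra of real polynomials invariant under $K$. The functions $\varphi_\xi$, $\xi\in\mathbb{R}^n$, are the bounded spherical functions of the Gelfand pair $(K,\mathbb{R}^n)$. The Gelfand (spherical Fourier) transform of an integrable $K$-invariant function $g$ is $\mathcal{F}(g)(\varphi_\xi)=\int_{\mathbb{R}^n}g(x)\,\varphi_\xi(-x)\,dx$. A complex-valued function on $\mathbb{R}^\ell$ is real analytic if near each point it is the sum of a convergent power series with complex coefficients. *)

(* Defs.v *)
From HB Require Import structures.
From mathcomp Require Import all_boot all_order all_algebra finmap.
From mathcomp Require Import all_classical all_reals all_analysis measurable_realfun.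
From mathcomp Require Import complex.
(* Not imported: the notations of mpoly clash with those of
   mathcomp-analysis, hence the qualified names below. *)
From mathcomp Require mpoly.

Set Implicit Arguments.
Unset Strict Implicit.
Unset Printing Implicit Defensive.

Import Order.TTheory GRing.Theory Num.Theory.
Import numFieldNormedType.Exports.

Local Open Scope classical_set_scope.
Local Open Scope ring_scope.

(* The elements of R^n are the column vectors 'cV[R]_n, on which a matrix k
   acts by x |-> k *m x. *)

Definition mx_borel_display : measure_display. Proof. by constructor. Qed.

Section mx_borel.
Variables (R : realType) (m n : nat).

Definition mx_borel : set (set 'M[R]_(m, n)) := <<s open >>.

Let mx_borel0 : mx_borel set0. Proof. exact: sigma_algebra0. Qed.

Let mx_borelC A : mx_borel A -> mx_borel (~` A).
Proof. by move=> mA; rewrite -setTD; exact: sigma_algebraCD. Qed.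

Let mx_borel_bigcup (F : (set 'M[R]_(m, n))^nat) :
  (forall i, mx_borel (F i)) -> mx_borel (\bigcup_i F i).
Proof. exact: sigma_algebra_bigcup. Qed.

HB.instance Definition _ := @isMeasurable.Build mx_borel_display
  'M[R]_(m, n) mx_borel mx_borel0 mx_borelC mx_borel_bigcup.

End mx_borel.

Section mx_measurable.
Variables (R : realType) (m n : nat).

Let box (c : 'M[rat]_(m, n) * nat) : set 'M[R]_(m, n) :=
  [set M | forall i j, `|M i j - ratr (c.1 i j)| < c.2.+1%:R^-1].

Let open_boxes (U : set 'M[R]_(m, n)) : open U ->
  U = \bigcup_c (if `[< box c `<=` U >] then box c else set0).
Proof.
move=> oU; apply/seteqP; split=> [M UM|M [c _]]; last first.
  by case: asboolP => // + ?; apply.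
have /nbhs_ballP[e /= e0 eU] : nbhs M U by move: oU; rewrite openE; apply.
have [k _ ke] : \forall k \near \oo, (k.+1%:R^-1 : R) < e / 2.
  by apply: (near_infty_natSinv_lt (PosNum (divr_gt0 e0 (ltr0Sn _ 1)))).
have {}ke := ke k (leqnn k).
have ratP i j : exists q : rat, `|M i j - ratr q| < (k.+1%:R^-1 : R).
  have [|q] := @rat_in_itvoo R (M i j - k.+1%:R^-1) (M i j + k.+1%:R^-1).
    by rewrite ltrD2l gtrN// invr_gt0.
  by rewrite in_itv /= => /andP[q1 q2]; exists q; rewrite ltr_distlC q1 q2.
pose q := \matrix_(i, j) xget 0 [set q : rat | `|M i j - ratr q| < (k.+1%:R^-1 : R)].
have Mq : box (q, k) M.
  move=> i j; rewrite mxE.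
  by case: xgetP => [y _ //|noq]; have [y /noq] := ratP i j.
exists (q, k) => //; case: asboolP => // -[]; move=> N Nq; apply: eU.
split=> // i j; rewrite /ball/=.
have -> : M i j - N i j = (M i j - ratr (q i j)) - (N i j - ratr (q i j)).
  by rewrite opprB addrA subrK.
rewrite (le_lt_trans (ler_normB _ _))// [e]splitr ltrD//.
  by rewrite (lt_trans (Mq i j)).
by rewrite (lt_trans (Nq i j)).
Qed.

Lemma measurable_fun_mx d (T : measurableType d) (f : T -> 'M[R]_(m, n)) :
  (forall i j, measurable_fun setT (fun x => f x i j)) ->
  measurable_fun setT f.
Proof.
move=> mf; apply: (@measurability _ _ _ _ _ _ (@open 'M[R]_(m, n))) => //.
move=> _ [U oU <-]; rewrite setTI (open_boxes oU) preimage_bigcup.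
apply: countable_bigcupT_measurable => // c.
case: ifP => _; last by rewrite preimage_set0.
rewrite (_ : _ @^-1` _ = \bigcap_(ij in [set: 'I_m * 'I_n])
    [set x | `|f x ij.1 ij.2 - ratr (c.1 ij.1 ij.2)| < c.2.+1%:R^-1]).
  apply: fin_bigcap_measurable => // -[i j] _ /=.
  rewrite -[X in measurable X]setTI.
  rewrite (_ : [set x | _] = (fun x => `|f x i j - ratr (c.1 i j)|) @^-1`
      `]-oo, (c.2.+1%:R^-1 : R)[); last first.
    by apply/seteqP; split=> x /=; rewrite in_itv.
  have mg : measurable_fun setT (fun x => `|f x i j - ratr (c.1 i j)|).
    apply: (measurableT_comp (@normr_measurable R setT)).
    by apply: measurable_funB => //; exact: mf.
  exact: mg.
by apply/seteqP; split=> x /= h => [[i j] _|i j]; [exact: h|exact: (h (i, j))].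
Qed.

Lemma measurable_coord_mx i j :
  measurable_fun setT (fun M : 'M[R]_(m, n) => M i j).
Proof.
apply: (measurability _ (RGenOpens.measurableE R)) => _ [_ [a [b ->]] <-].
rewrite setTI; apply: sub_sigma_algebra; apply: open_comp => //.
by move=> M _; exact: coord_continuous.
Qed.

End mx_measurable.

Section lebesgue_cV.
Variable R : realType.

Definition cons_cV n (p : R * 'cV[R]_n) : 'cV[R]_n.+1 :=
  col_mx (const_mx p.1 : 'cV[R]_1) p.2.

Let uncons_cV n (x : 'cV[R]_n.+1) : R * 'cV[R]_n :=
  (x ord0 ord0, \col_i x (lift ord0 i) ord0).

Let cons_cVE n (p : R * 'cV[R]_n) i j :
  cons_cV p i j = if unlift ord0 i is Some k then p.2 k ord0 else p.1.
Proof.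
rewrite (ord1 j) /cons_cV; case: unliftP => [k ->|->].
  by rewrite -rshift1; exact: (@col_mxEd _ 1 n 1).
rewrite (_ : ord0 = @lshift 1 n ord0 :> 'I_n.+1); last exact: ord_inj.
by rewrite [LHS](@col_mxEu _ 1 n 1) mxE.
Qed.

Let cons_cVK n : cancel (@cons_cV n) (@uncons_cV n).
Proof.
move=> [a x]; congr pair; rewrite ?cons_cVE ?unlift_none//.
by apply/colP => i; rewrite mxE cons_cVE liftK.
Qed.

Lemma measurable_cons_cV n : measurable_fun setT (@cons_cV n).
Proof.
apply: measurable_fun_mx => i j; under eq_fun do rewrite cons_cVE.
case: (unlift ord0 i) => [k|]; last exact: measurable_fst.
exact: (measurableT_comp (measurable_coord_mx k ord0) measurable_snd).
Qed.

Let measurable_uncons_cV n : measurable_fun setT (@uncons_cV n).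
Proof.
apply: measurable_fun_pair; first exact: measurable_coord_mx.
apply: measurable_fun_mx => i j; under eq_fun do rewrite mxE.
exact: measurable_coord_mx.
Qed.

Section step.
Variables (n : nat) (mu : {sigma_finite_measure set 'cV[R]_n -> \bar R}).

Let prod_mu : {measure set (measurableTypeR R * 'cV[R]_n)%type -> \bar R} :=
  (lebesgue_measure \x mu)%E.

Definition lebesgue_cVS : set 'cV[R]_n.+1 -> \bar R :=
  pushforward (lebesgue_measure \x mu)%E (@cons_cV n).

Let lebesgue_cVS0 : lebesgue_cVS set0 = 0%E.
Proof. by rewrite /lebesgue_cVS /pushforward preimage_set0 measure0. Qed.

Let lebesgue_cVS_ge0 A : (0 <= lebesgue_cVS A)%E.
Proof. exact: (measure_ge0 prod_mu). Qed.

Let lebesgue_cVS_sigma_additive : semi_sigma_additive lebesgue_cVS.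
Proof.
exact: (@measure_semi_sigma_additive _ _ _
  (measure_function_pushforward__canonical__measure_function_Measure
    prod_mu (@measurable_cons_cV n))).
Qed.

HB.instance Definition _ := isMeasure.Build _ _ _ lebesgue_cVS
  lebesgue_cVS0 lebesgue_cVS_ge0 lebesgue_cVS_sigma_additive.

Let lebesgue_cVS_sigma_finite : sigma_finite setT lebesgue_cVS.
Proof.
have /sigma_finiteP[F [FT ndF Foo]] := sigma_finiteT (@lebesgue_measure R).
have /sigma_finiteP[G [GT ndG Goo]] := sigma_finiteT mu.
exists (fun k => @uncons_cV n @^-1` (F k `*` G k)).
  rewrite -preimage_bigcup (_ : \bigcup_k _ = setT) ?preimage_setT//.
  apply/seteqP; split=> // -[a x] _.
  have [k _ Fa] : (\bigcup_k F k) a by rewrite -FT.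
  have [l _ Gx] : (\bigcup_k G k) x by rewrite -GT.
  exists (maxn k l) => //; split => /=.
    by move: a Fa; exact/subsetPset/ndF/leq_maxl.
  by move: x Gx; exact/subsetPset/ndG/leq_maxr.
move=> k; have [mF Fk] := Foo k; have [mG Gk] := Goo k; split.
  rewrite -[X in measurable X]setTI; apply: measurable_uncons_cV => //.
  exact: measurableX.
rewrite /lebesgue_cVS /pushforward.
rewrite (_ : _ @^-1` _ = F k `*` G k); last first.
  by apply/funext => p; exact: (congr1 (F k `*` G k) (cons_cVK p)).
by rewrite product_measure1E// lte_mul_pinfty// ge0_fin_numE.
Qed.

HB.instance Definition _ := Measure_isSigmaFinite.Build _ _ _ lebesgue_cVS
  lebesgue_cVS_sigma_finite.

End step.

(* Iterated product of the Lebesgue measure of R; R^0 is a point of mass 1. *)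
Fixpoint lebesgue_cV n : {sigma_finite_measure set 'cV[R]_n -> \bar R} :=
  if n is k.+1 then lebesgue_cVS (lebesgue_cV k) else \d_(0 : 'cV[R]_0).

Lemma lebesgue_cV_box n (A : 'I_n -> set R) :
  (forall i, measurable (A i)) ->
  lebesgue_cV n [set x | forall i, A i (x i ord0)] =
  (\prod_i lebesgue_measure (A i))%E.
Proof.
elim: n A => [|n IH] A mA.
  by rewrite big_ord0 /= diracE mem_set//= => -[].
rewrite big_ord_recl /= -IH //.
rewrite /lebesgue_cVS /pushforward -product_measure1E//; last first.
- rewrite (_ : (fun x => _) = \bigcap_(i in setT)
      ((fun x : 'cV[R]_n => x i ord0) @^-1` A (lift ord0 i))).
    apply: fin_bigcap_measurable => // i _; rewrite -[X in measurable X]setTI.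
    by apply: measurable_coord_mx => //; exact: mA.
  by apply/seteqP; split=> x /= h i; [move=> _; exact: h|exact: h].
- exact: mA.
congr (_ _); apply/seteqP; split=> -[a x] /=; rewrite /preimage /=.
  move=> h; split=> [|i].
    by have := h ord0; rewrite cons_cVE unlift_none.
  by have := h (lift ord0 i); rewrite cons_cVE liftK.
move=> [Aa Ax] i; rewrite cons_cVE.
by case: unliftP => [k ->|->]//; exact: Ax.
Qed.

End lebesgue_cV.

Definition Cintegral d (T : measurableType d) (R : realType)
    (mu : {measure set T -> \bar R}) (D : set T) (f : T -> R[i]) : R[i] :=
  ((\int[mu]_(x in D) complex.Re (f x)) +i*
   (\int[mu]_(x in D) complex.Im (f x)))%C.

Definition Cintegrable d (T : measurableType d) (R : realType)
    (mu : {measure set T -> \bar R}) (D : set T) (f : T -> R[i]) : Prop :=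
  mu.-integrable D (fun x => (complex.Re (f x))%:E) /\
  mu.-integrable D (fun x => (complex.Im (f x))%:E).

Definition expi (R : realType) (theta : R) : R[i] :=
  (cos theta +i* sin theta)%C.

(* Functions all of whose partial derivatives of order at most k exist and are
   continuous. *)
Fixpoint Ck (R : realType) n (k : nat) (f : 'cV[R]_n -> R) : Prop :=
  continuous f /\
  if k is k'.+1 then
    forall i : 'I_n, let e_i : 'cV[R]_n := delta_mx i ord0 in
      (forall x, derivable f x e_i) /\ Ck k' (fun x => 'D_e_i f x)
  else True.

Definition Csmooth (R : realType) n (f : 'cV[R]_n -> R[i]) : Prop :=
  forall k, Ck k (fun x => complex.Re (f x)) /\
            Ck k (fun x => complex.Im (f x)).

Definition compactly_supported (R : realType) n (f : 'cV[R]_n -> R[i]) : Prop :=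
  compact (closure [set x | f x != 0]).

(* Unordered summation, that is, absolute convergence. *)
Definition has_sum (R : realType) (I : choiceType) (u : I -> R[i]) (s : R[i]) :
    Prop :=
  forall e : R, 0 < e -> exists A : {fset I}, forall B : {fset I},
    (A `<=` B)%fset -> `|\sum_(i <- B) u i - s| < (e%:C)%C.

Definition monomial (R : realType) l (m : {ffun 'I_l -> nat})
    (x : 'cV[R]_l) : R :=
  \prod_j x j ord0 ^+ m j.

Definition real_analytic (R : realType) l (f : 'cV[R]_l -> R[i]) : Prop :=
  forall a : 'cV[R]_l, exists c : {ffun 'I_l -> nat} -> R[i],
    \forall t \near a,
      has_sum (fun m => c m * ((monomial m (t - a))%:C)%C) (f t).

Definition orthogonal_subgroup (R : realType) n (K : set 'M[R]_n) : Prop :=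
  [/\ K 1%:M,
      forall k k', K k -> K k' -> K (k *m k'),
      forall k, K k -> K (invmx k) &
      forall k, K k -> k^T *m k = 1%:M].

(* The normalized Haar measure of a compact matrix group K, seen as a Borel
   measure on the ambient space of matrices that is carried by K. *)
Definition normalized_haar (R : realType) n (K : set 'M[R]_n)
    (dk : probability 'M[R]_n R) : Prop :=
  dk K = 1%E /\
  forall k A, K k -> measurable A -> A `<=` K -> dk (mulmx k @` A) = dk A.

Definition invariant_fun (R : realType) n (K : set 'M[R]_n) T
    (f : 'cV[R]_n -> T) : Prop :=
  forall k x, K k -> f (k *m x) = f x.

Definition peval (R : realType) n (p : mpoly.mpoly n R) (x : 'cV[R]_n) : R :=
  mpoly.meval (fun i => x i ord0) p.

Definition invariant_poly (R : realType) n (K : set 'M[R]_n)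
    (p : mpoly.mpoly n R) : Prop :=
  invariant_fun K (peval p).

Definition generate_invariants (R : realType) n l (K : set 'M[R]_n)
    (rho : l.-tuple (mpoly.mpoly n R)) : Prop :=
  (forall j, invariant_poly K (tnth rho j)) /\
  forall p, invariant_poly K p ->
    exists q : mpoly.mpoly l R, p = mpoly.comp_mpoly rho q.

Definition peval_tuple (R : realType) n l (rho : l.-tuple (mpoly.mpoly n R))
    (x : 'cV[R]_n) : 'cV[R]_l :=
  \col_j peval (tnth rho j) x.

Definition dotp (R : realType) n (x y : 'cV[R]_n) : R :=
  \sum_i x i ord0 * y i ord0.

Definition spherical (R : realType) n (K : set 'M[R]_n)
    (dk : probability 'M[R]_n R) (xi x : 'cV[R]_n) : R[i] :=
  Cintegral dk K (fun k => expi (dotp x (k *m xi))).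

Definition gelfand_transform (R : realType) n (g phi : 'cV[R]_n -> R[i]) :
    R[i] :=
  Cintegral (@lebesgue_cV R n) setT (fun x => g x * phi (- x)).

(* Main.v *)
(* Write phi_xi(x) = sum_m i^m P_{m,xi}(x), where P_{m,xi}(x) is the integral over
   K of <x, k xi>^m / m!; this is a K-invariant polynomial in x, hence of the form
   Q_{m,xi} o rho. The point is to choose Q_{m,xi} so that sum_m i^m Q_{m,xi}
   converges on R^l. Let L(f), for f in R[x], be the normal form of f modulo the
   ideal (t_j - rho_j(x)) of R[t, x] for the lexicographic order with x > t,
   restricted to x = 0. If f lies in R[rho], the normal form involves only t and
   L(f) o rho = f. The ideal has a finite Groebner basis (Dickson), and for weights
   that grow fast enough along the lexicographic order each leading term dominates
   its tail, so that taking normal forms does not increase the weighted l1 norm of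
   the coefficients. Hence for each r there is C with ||L(x^a)||_r <= C^|a|, and
   with Q_{m,xi} = L(P_{m,xi}) the factor 1/m! makes the series an entire function
   h_xi, with bounds that are locally uniform in xi.

   Integrating the series against g term by term, h is again an entire series.
   Finally phi_eta(xi) = phi_xi(eta), since the Haar measure of K is invariant
   under inversion, and the last identity is the change of variable xi -> - xi. *)
Require Import Defs.
From HB Require Import structures.
From mathcomp Require Import all_boot all_order all_algebra finmap.
From mathcomp Require Import all_classical all_reals all_analysis measurable_realfun.
From mathcomp Require Import complex ring lra zify.
From mathcomp Require mpoly.

Set Implicit Arguments.
Unset Strict Implicit.
Unset Printing Implicit Defensive.

Import Order.TTheory GRing.Theory Num.Theory.
Import numFieldNormedType.Exports.

Local Open Scope classical_set_scope.
Local Open Scope ring_scope.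

(** * Dickson's lemma and weighted l1 norms of polynomials *)

(** The generators may satisfy relations, so an invariant polynomial has many expressions in them,
    and choosing each $Q_{m,\xi}$ separately would give no control as $m$ grows. A linear map [L],
    fixed once on the monomials, removes the choice: only the $L(x^a)$ have to be estimated. The
    lexicographic order, needed to eliminate x, gives no evident bound on the degree of $L(x^a)$ in
    t; the weighted norm is what stays under control, and it suffices for convergence. The order of
    the choices matters: the basis and the normal forms are fixed before the weights, which depend
    on r, so that one [L] serves every radius. All the analysis rests on one condition on a sequence
    of polynomials: at every radius r the norm of the m-th one is at most $D(r)/2^m$. It survives
    translation and differentiation. The powers of 2 come from $y^m/m! \le e^{2y}/2^m$. Polynomials
    stay real throughout: $i^m$ is split into two sequences of signs. *)

(** Induction on the number of coordinates: the tails of [S] have a finite basis [F'], and [h] picks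
    a head for each of its elements. Once the head of [s] is at least the maximum [M] of these, [F']
    is enough; the finitely many slices with a smaller head are handled separately by the induction
    hypothesis. *)
Lemma dickson k (S : k.-tuple nat -> Prop) :
  exists F : seq (k.-tuple nat), (forall f, f \in F -> S f) /\
    forall s, S s -> exists2 f, f \in F & forall i, (tnth f i <= tnth s i)%N.
Proof.
elim: k S => [|k IH] S.
  have [S0|nS0] := pselect (S [tuple]).
    exists [:: [tuple]]; split=> [f|s _]; first by rewrite (tuple0 f).
    by exists [tuple]; rewrite ?inE// => -[].
  by exists [::]; split=> // s; rewrite (tuple0 s).
have [F' [F'S F'P]] := IH (fun t => exists a, S [tuple of a :: t]).
have [h hP] : {h : k.-tuple nat -> nat & forall t, t \in F' ->
    S [tuple of h t :: t]}.
  apply: (choice (P := fun t a => t \in F' -> S [tuple of a :: t])) => t.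
  have [tF|ntF] := boolP (t \in F'); last by exists 0%N.
  by have [a Sa] := F'S _ tF; exists a.
have [G GP] := choice (fun c => IH (fun t => S [tuple of c :: t])).
pose M := (\max_(t <- F') h t)%N.
exists ([seq [tuple of h t :: t] | t : k.-tuple nat <- F'] ++
  flatten [seq [seq [tuple of c :: t] | t : k.-tuple nat <- G c] | c <- iota 0 M]).
split=> [f|s].
  rewrite mem_cat => /orP[/mapP[t tF ->]|/flattenP[_ /mapP[c _ ->] /mapP[t tG ->]]].
    exact: hP.
  exact: (GP c).1.
have [c {}s] := tupleP s => Ss.
have [lecM|ltcM] := leqP M c.
  have [t tF tle] := F'P s (ex_intro _ c Ss).
  exists [tuple of h t :: t].
    by rewrite mem_cat; apply/orP; left; apply/mapP; exists t.
  move=> i; have [->|[j ->]] : i = ord0 \/ exists j, i = lift ord0 j.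
    by case: (unliftP ord0 i) => [j ->|->]; [right; exists j|left].
    rewrite !tnth0 (leq_trans _ lecM)//.
    by rewrite /M (big_rem t)//= leq_maxl.
  by rewrite !tnthS.
have [t tG tle] := (GP c).2 _ Ss.
exists [tuple of c :: t].
  rewrite mem_cat; apply/orP; right; apply/flattenP.
  exists [seq [tuple of c :: t] | t : k.-tuple nat <- G c].
    by apply/mapP; exists c; rewrite // mem_iota.
  by apply/mapP; exists t.
move=> i; have [->|[j ->]] : i = ord0 \/ exists j, i = lift ord0 j.
  by case: (unliftP ord0 i) => [j ->|->]; [right; exists j|left].
  by rewrite !tnth0.
by rewrite !tnthS.
Qed.

Section WeightedNorm.
Import -(notations) mpoly.
Variables (R : realFieldType) (k : nat).
Local Notation "p @_ m" := (mcoeff m p) (at level 2, m at level 2).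
Implicit Types (w : 'I_k -> R) (p q : mpoly k R) (m : multinom k).

Definition wmon w m : R := \prod_i w i ^+ m i.

(** Value at [w] of the polynomial whose coefficients are the absolute values of those of [p]; for
    nonnegative [w] it bounds [p] on the box $|x_i| \le w_i$ and is submultiplicative. *)
Definition wnorm w p : R := \sum_(m <- msupp p) `|p@_m| * wmon w m.

Lemma wmon_ge0 w m : (forall i, 0 <= w i) -> 0 <= wmon w m.
Proof. by move=> w0; apply: prodr_ge0 => i _; rewrite exprn_ge0. Qed.

Lemma wmonD w m1 m2 : wmon w (mnm_add m1 m2) = wmon w m1 * wmon w m2.
Proof. by rewrite /wmon -big_split; apply: eq_bigr => i _; rewrite mnmDE exprD. Qed.

Lemma wmon0 w : wmon w (@mnm0 k) = 1.
Proof. by rewrite /wmon big1// => i _; rewrite mnm0E. Qed.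

Lemma wmonU w i : wmon w (mnm1 i) = w i.
Proof.
rewrite /wmon (bigD1 i)//= mnm1E eqxx expr1 big1 ?mulr1// => j ji.
by rewrite mnm1E eq_sym (negbTE ji).
Qed.

Lemma wmon_const (r : R) m : wmon (fun=> r) m = r ^+ mdeg m.
Proof. by rewrite /wmon mdegE prodrXr. Qed.

Lemma sum_msupp_sup (V : nmodType) (F : multinom k -> V) p
    (s : seq (multinom k)) : uniq s -> {subset msupp p <= s} ->
  (forall m, p@_m = 0 -> F m = 0) ->
  \sum_(m <- msupp p) F m = \sum_(m <- s) F m.
Proof.
move=> us ps F0; rewrite [RHS](bigID (mem (msupp p)))/=.
rewrite [X in _ = _ + X]big1 ?addr0; last first.
  by move=> m mp; rewrite F0// memN_msupp_eq0.
rewrite -[RHS]big_filter; apply: perm_big; apply: uniq_perm.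
- exact: msupp_uniq.
- exact: filter_uniq.
- by move=> m; rewrite mem_filter andb_idr// => /ps.
Qed.

Lemma wnorm_sup w p (s : seq (multinom k)) : uniq s ->
  {subset msupp p <= s} -> wnorm w p = \sum_(m <- s) `|p@_m| * wmon w m.
Proof.
move=> us ps; apply: sum_msupp_sup => // m ->.
by rewrite normr0 mul0r.
Qed.

Section nonneg.
Variable w : 'I_k -> R.
Hypothesis w0 : forall i, 0 <= w i.

Lemma wnorm_ge0 p : 0 <= wnorm w p.
Proof. by apply: sumr_ge0 => m _; rewrite mulr_ge0// wmon_ge0. Qed.

Lemma wnorm0 : wnorm w 0 = 0.
Proof. by rewrite /wnorm msupp0 big_nil. Qed.

Lemma wnormX m : wnorm w (mpolyX R m) = wmon w m.
Proof. by rewrite /wnorm msuppX big_seq1 mcoeffX eqxx normr1 mul1r. Qed.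

Lemma wnormZ c p : wnorm w (c *: p) = `|c| * wnorm w p.
Proof.
rewrite (@wnorm_sup _ _ (msupp p)) ?msupp_uniq//; last exact: msuppZ_le.
rewrite mulr_sumr; apply: eq_bigr => m _.
by rewrite mcoeffZ normrM mulrA.
Qed.

Lemma ler_wnormD p q : wnorm w (p + q) <= wnorm w p + wnorm w q.
Proof.
pose s := undup (msupp p ++ msupp q).
have ps : {subset msupp p <= s} by move=> m mp; rewrite mem_undup mem_cat mp.
have qs : {subset msupp q <= s}.
  by move=> m mq; rewrite mem_undup mem_cat mq orbT.
rewrite (@wnorm_sup _ _ s) ?undup_uniq//; last first.
  by move=> m /msuppD_le; rewrite mem_undup.
rewrite (wnorm_sup _ _ ps) ?undup_uniq// (wnorm_sup _ _ qs) ?undup_uniq//.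
rewrite -big_split/= ler_sum// => m _.
by rewrite mcoeffD -mulrDl ler_wpM2r ?wmon_ge0// ler_normD.
Qed.

Lemma ler_wnorm_sum (I : Type) (s : seq I) (P : pred I) (F : I -> mpoly k R) :
  wnorm w (\sum_(i <- s | P i) F i) <= \sum_(i <- s | P i) wnorm w (F i).
Proof.
elim/big_rec2: _ => [|i x p _ px]; first by rewrite wnorm0.
by rewrite (le_trans (ler_wnormD _ _))// lerD2l.
Qed.

Lemma ler_wnormM p q : wnorm w (p * q) <= wnorm w p * wnorm w q.
Proof.
rewrite [X in wnorm w (X * _)]mpolyE [X in wnorm w (_ * X)]mpolyE mulr_suml.
apply: le_trans (ler_wnorm_sum _ _ _) _.
rewrite {3}/wnorm mulr_suml ler_sum// => m _.
rewrite mulr_sumr; apply: le_trans (ler_wnorm_sum _ _ _) _.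
rewrite /(wnorm w q) mulr_sumr ler_sum// => m' _.
rewrite -scalerAl -scalerAr -mpolyXD !wnormZ wnormX wmonD.
by rewrite [leRHS]mulrACA mulrA.
Qed.

Lemma wnorm1 : wnorm w 1 = 1.
Proof. by rewrite -mpolyX0 wnormX wmon0. Qed.

Lemma wnormC c : wnorm w (mpolyC k c) = `|c|.
Proof. by rewrite -alg_mpolyC wnormZ wnorm1 mulr1. Qed.

Lemma ler_wnorm_prod (I : Type) (s : seq I) (P : pred I) (F : I -> mpoly k R)
    (B : I -> R) : (forall i, P i -> wnorm w (F i) <= B i) ->
  wnorm w (\prod_(i <- s | P i) F i) <= \prod_(i <- s | P i) B i.
Proof.
move=> FB; elim/big_rec2: _ => [|i x p Pi px]; first by rewrite wnorm1.
by rewrite (le_trans (ler_wnormM _ _))// ler_pM ?wnorm_ge0// FB.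
Qed.

Lemma ler_wnormX p j : wnorm w (p ^+ j) <= wnorm w p ^+ j.
Proof.
elim: j => [|j IH]; first by rewrite !expr0 wnorm1.
by rewrite !exprS (le_trans (ler_wnormM _ _))// ler_wpM2l ?wnorm_ge0.
Qed.

Lemma ler_norm_meval p (v : 'I_k -> R) : (forall i, `|v i| <= w i) ->
  `|meval v p| <= wnorm w p.
Proof.
move=> vw; rewrite mevalE (le_trans (ler_norm_sum _ _ _))// ler_sum// => m _.
rewrite normrM ler_wpM2l// normr_prod; apply: ler_prod => i _.
by rewrite normr_ge0/= normrX lerXn2r// nnegrE.
Qed.

End nonneg.

End WeightedNorm.

(** * Lexicographic normal forms with norm bounds *)

Section LexOrder.
Import -(notations) mpoly.
Variable k : nat.
Implicit Types m : multinom k.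

Definition lexlt m1 m2 : Prop :=
  exists2 i : 'I_k, forall j : 'I_k, (j < i)%N -> m1 j = m2 j & (m1 i < m2 i)%N.

Let lexltP m1 m2 : lexlt m1 m2 <->
  ((val m1 : k.-tuplelexi nat) < (val m2 : k.-tuplelexi nat))%O.
Proof.
by split=> [[i eqi lti]|/ltxi_tuplePlt[i eqi lti]];
  [apply/ltxi_tuplePlt; exists i|exists i].
Qed.

Lemma lexlt_trans m2 m1 m3 : lexlt m1 m2 -> lexlt m2 m3 -> lexlt m1 m3.
Proof. by move=> /lexltP m12 /lexltP m23; apply/lexltP/(lt_trans m12). Qed.

Lemma lexlt_total m1 m2 : [\/ m1 = m2, lexlt m1 m2 | lexlt m2 m1].
Proof.
have := ltgtP (val m1 : k.-tuplelexi nat) (val m2 : k.-tuplelexi nat).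
by case=> [/lexltP|/lexltP|/val_inj]; [constructor 2|constructor 3|constructor 1].
Qed.

Lemma lexlt_add2l m m1 m2 : lexlt m1 m2 -> lexlt (mnm_add m m1) (mnm_add m m2).
Proof.
move=> [i eqi lti]; exists i => [j ji|]; rewrite !mnmDE.
  by rewrite eqi.
by rewrite ltn_add2l.
Qed.

(** Infinitely many monomials may lie below a given one, so reduction cannot be an induction on a
    finite set; it terminates because the lexicographic order on tuples of fixed length is
    well-founded. *)
Lemma lexlt_ind (P : multinom k -> Prop) :
  (forall m, (forall m', lexlt m' m -> P m') -> P m) -> forall m, P m.
Proof.
move=> ih m; suff: forall t : k.-tuplelexi nat, P (Multinom t).
  by move=> /(_ (val m)); case: m.
apply: (@ssrcomplements.ltxwf _ nat) => [Q ihQ x|t iht].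
  elim/ltn_ind: x => x IHx; apply: ihQ => y yx; exact: IHx.
by apply: ih => m' /lexltP/iht; case: m'.
Qed.

Lemma lexlt_max (s : seq (multinom k)) : s != [::] ->
  exists2 m, m \in s & forall m', m' \in s -> m' = m \/ lexlt m' m.
Proof.
elim: s => // m [|m1 s] IH _.
  by exists m; rewrite ?mem_head// => m'; rewrite inE => /eqP; left.
have [//|m2 m2s m2P] := IH _.
have [m2m|mm2|m2m] := lexlt_total m m2.
- exists m; first exact: mem_head.
  move=> m'; rewrite inE => /predU1P[|/m2P]; first by left.
  by rewrite m2m.
- exists m2; first by rewrite inE m2s orbT.
  move=> m'; rewrite inE => /predU1P[->|/m2P//]; by right.
- exists m; first exact: mem_head.
  move=> m'; rewrite inE => /predU1P[|/m2P[->|]]; [by left|by right|right].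
  exact: lexlt_trans m2m.
Qed.

End LexOrder.

Section LexCode.
Variable D : nat.

Definition lexcode k (f : 'I_k -> nat) : nat := (\sum_j f j * D ^ (k.-1 - j))%N.

Lemma lexcodeS k (f : 'I_k.+1 -> nat) : (lexcode f =
  f ord0 * D ^ k + lexcode (fun j => f (lift ord0 j)))%N.
Proof.
rewrite /lexcode big_ord_recl subn0; congr addn; apply: eq_bigr => j _.
by congr (_ * _ ^ _)%N; rewrite lift0 /=; lia.
Qed.

Lemma ltn_lexcode k (f : 'I_k -> nat) : (0 < D)%N -> (forall j, f j < D)%N ->
  (lexcode f < D ^ k)%N.
Proof.
move=> D0; elim: k f => [|k IH] f fD; first by rewrite /lexcode big_ord0.
rewrite lexcodeS.
have := IH (fun j => f (lift ord0 j)) (fun j => fD _).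
set c := lexcode _ => cD; have := fD ord0; set a := f _ => aD.
by rewrite expnS; nia.
Qed.

(** Only the smaller sequence needs digits below [D]: what follows its digit [i] is then worth less
    than one unit of that digit, while the later digits of [g] can only help. *)
Lemma lexcode_lt k (f g : 'I_k -> nat) (i : 'I_k) : (forall j, f j < D)%N ->
  (forall j : 'I_k, (j < i)%N -> f j = g j) -> (f i < g i)%N ->
  (lexcode f < lexcode g)%N.
Proof.
elim: k f g i => [|k IH] f g i fD; first by case: i.
have D0 : (0 < D)%N by apply: leq_ltn_trans (fD i).
case: (unliftP ord0 i) => [i' ->|->] eqfg ltfg; rewrite !lexcodeS; last first.
  have := @ltn_lexcode k (fun j => f (lift ord0 j)) D0 (fun j => fD _).
  set c := lexcode _ => cD; move: ltfg; set a := f _; set b := g _ => ab.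
  by apply: leq_trans (leq_addr _ _); nia.
rewrite eqfg// ltn_add2l; apply: (IH _ _ i') => // j ji; apply: eqfg.
by rewrite !lift0.
Qed.

End LexCode.

Section LexWeights.
Import -(notations) mpoly.
Variables (R : realFieldType) (k : nat).

(* The weights are [s ^ (D ^ (k - 1 - i))] with [s] large and [D] above all the
   exponents of the smaller monomials: the logarithm of a weighted monomial is
   then its base-[D] code, which is strictly increasing for the lexicographic
   order. *)
Lemma lex_weights (T : seq (multinom k * multinom k)) (r : R) :
  (forall t, t \in T -> lexlt t.1 t.2) ->
  exists w : 'I_k -> R, (forall i, r <= w i /\ 0 <= w i) /\
    forall t, t \in T -> r * wmon w t.1 <= wmon w t.2.
Proof.
move=> Tlt; pose D := (\max_(t <- T) \max_i t.1 i).+1.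
have TD t i : t \in T -> (t.1 i < D)%N.
  move=> tT; rewrite /D ltnS (big_rem t)//= leq_max; apply/orP; left.
  exact: leq_bigmax.
pose s := Num.max r 1.
have s1 : 1 <= s by rewrite le_max lexx orbT.
have s0 : 0 <= s by rewrite (le_trans ler01).
have sr : r <= s by rewrite le_max lexx.
exists (fun i : 'I_k => s ^+ (D ^ (k.-1 - i))).
have wcode m : wmon (fun i : 'I_k => s ^+ (D ^ (k.-1 - i))) m = s ^+ lexcode D m.
  rewrite /wmon -prodrXr; apply: eq_bigr => i _.
  by rewrite -exprM mulnC.
split=> [i|t tT].
  by rewrite exprn_ge0// (le_trans sr)// ler_eXnr// expn_gt0.
have [i eqi lti] := Tlt t tT.
(* A strict inequality between codes leaves room for one more factor [s], which absorbs [r]. *)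
rewrite !wcode (le_trans (ler_wpM2r _ sr)) ?exprn_ge0//.
rewrite -exprS ler_weXn2l//.
by apply: (@lexcode_lt D _ _ _ i) => // j; exact: TD.
Qed.

End LexWeights.

Section NormalForm.
Import -(notations) mpoly.
Variables (R : realFieldType) (k : nat).
Local Notation "p @_ m" := (mcoeff m p) (at level 2, m at level 2).
Local Notation "''X_[' m ]" := (mpolyX R m).
Implicit Types (w : 'I_k -> R) (p q : mpoly k R) (m : multinom k).

Lemma mem_msupp_sum (I : eqType) (s : seq I) (P : pred I) (F : I -> mpoly k R) m :
  m \in msupp (\sum_(i <- s | P i) F i) ->
  exists2 i, i \in s /\ P i & m \in msupp (F i).
Proof.
move=> /msupp_sum_le /flattenP[_ /mapP[i + ->]].
by rewrite mem_filter => /andP[Pi si] mi; exists i.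
Qed.

Variable J : mpoly k R -> Prop.
Hypothesis J0 : J 0.
Hypothesis JD : forall p q, J p -> J q -> J (p + q).
Hypothesis JM : forall p q, J q -> J (p * q).

Let JZ c p : J p -> J (c *: p).
Proof. by move=> Jp; rewrite -mul_mpolyC; exact: JM. Qed.

Let JB p q : J p -> J q -> J (p - q).
Proof. by move=> Jp Jq; apply: JD => //; rewrite -scaleN1r; exact: JZ. Qed.

Let Jsum (I : eqType) (s : seq I) (P : pred I) (F : I -> mpoly k R) :
  (forall i, i \in s -> P i -> J (F i)) -> J (\sum_(i <- s | P i) F i).
Proof.
move=> JF; rewrite big_seq_cond; elim/big_rec: _ => // i p /andP[si Pi] Jp.
by apply: JD => //; exact: JF.
Qed.

Definition lead_witness m p :=
  [/\ J p, p@_m = 1 & forall m', m' \in msupp p -> m' = m \/ lexlt m' m].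

Definition lead_mnm m := exists p, lead_witness m p.

(** Uniqueness of normal forms, applied to a difference of two: were it nonzero, its largest
    monomial would be a leading monomial of [J]. *)
Lemma no_lead_mnm_eq0 p : J p -> (forall m, m \in msupp p -> ~ lead_mnm m) ->
  p = 0.
Proof.
move=> Jp pN; have [/eqP|/lexlt_max[m mp mP]] := eqVneq (msupp p) [::].
  by rewrite msupp_eq0 => /eqP.
have p0 : p@_m != 0 by rewrite -mcoeff_msupp.
case: (pN _ mp); exists ((p@_m)^-1 *: p); split.
- exact: JZ.
- by rewrite mcoeffZ mulVf.
- by move=> m' /msuppZ_le /mP.
Qed.

(* For such weights, rewriting a leading monomial [m] into the tail of [G m] does
   not increase the weighted norm. *)
Definition dominates w (F : seq (multinom k)) (G : multinom k -> mpoly k R) :=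
  (forall i, 0 <= w i) /\ forall m, m \in F ->
    \sum_(m' <- msupp (G m) | m' != m) `|(G m)@_m'| * wmon w m' <= wmon w m.

(** Dickson's lemma applied to the set of all leading monomials gives the Groebner basis, with no
    algorithm. [F] and [G] come before [r] in the statement, so that normal forms do not depend on
    the radius. *)
Lemma lead_basis : exists F G,
  [/\ forall m, m \in F -> lead_witness m (G m),
      forall m, lead_mnm m -> exists2 m', m' \in F & lem m' m &
      forall r : R, exists w, (forall i, r <= w i) /\ dominates w F G].
Proof.
have [F [Flead FP]] := dickson (fun t => lead_mnm (@Multinom k t)).
have [G GP] : {G : multinom k -> mpoly k R & forall m, val m \in F ->
    lead_witness m (G m)}.
  apply: (choice (P := fun (m : multinom k) p => val m \in F -> lead_witness m p)).
  move=> m; have [mF|mNF] := boolP (val m \in F); last by exists 0.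
  by have [p pP] := Flead _ mF; exists p; case: m mF pP.
exists [seq @Multinom k t | t <- F], G; split => [_ /mapP[t tF ->]|m mlead|r].
- exact: GP.
- have [|t tF tm] := FP (val m); first by case: m mlead.
  exists (@Multinom k t); first by apply/mapP; exists t.
  by apply/forallP => i; exact: tm.
(* All pairs of a tail monomial and the leading monomial that must dominate it. *)
pose T := flatten [seq [seq (m', @Multinom k t) |
  m' <- msupp (G (@Multinom k t)) & m' != @Multinom k t] | t <- F].
(* [s] bounds the sum of the absolute tail coefficients of every [G m]. Weights that gain a factor
   at least [s] on each pair of [T] make the whole tail, and not just each monomial, weigh at most
   its leading monomial; the 1 in the maximum keeps this factor positive. *)
pose s := \sum_(t <- F) \sum_(m' <- msupp (G (@Multinom k t)))
  `|(G (@Multinom k t))@_m'|.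
have [|w [wr wT]] := @lex_weights R k T (Num.max r (Num.max 1 s)).
  move=> _ /flattenP[_ /mapP[t tF ->] /mapP[m' + ->]]/=.
  rewrite mem_filter => /andP[m't m'G].
  have [_ _ /(_ _ m'G)[mt|//]] := GP (@Multinom k t) tF.
  by rewrite mt eqxx in m't.
exists w; split=> [i|]; first by rewrite (le_trans _ (wr i).1)// le_max lexx.
split=> [i|_ /mapP[t tF ->]]; first exact: (wr i).2.
set m := Multinom t; set r' := Num.max r _ in wr wT.
have r'0 : 0 < r' by rewrite (@lt_le_trans _ _ 1)// !le_max lexx orbT.
rewrite -(ler_pM2l r'0) mulr_sumr.
have w0 i := (wr i).2.
apply: (@le_trans _ _ (\sum_(m' <- msupp (G m) | m' != m) `|(G m)@_m'| * wmon w m)).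
  rewrite big_seq_cond [leRHS]big_seq_cond; apply: ler_sum => m' /andP[m'G m'm].
  rewrite mulrCA ler_wpM2l//; apply: (wT (m', m)).
  apply/flattenP; eexists; first by apply/mapP; exists t.
  by apply/mapP; exists m'; rewrite // mem_filter m'm.
rewrite -mulr_suml ler_wpM2r ?wmon_ge0//.
apply: (@le_trans _ _ s); last by rewrite !le_max lexx !orbT.
rewrite /s (big_rem t)//= -[leLHS]addr0 lerD//; last first.
  by rewrite sumr_ge0// => t' _; rewrite sumr_ge0.
by rewrite [leRHS](bigID (fun m' => m' != m))/= lerDl sumr_ge0.
Qed.

(** If a basis element [G m] has leading monomial dividing $x^a$, subtracting its multiple replaces
    $x^a$ by smaller monomials, which have normal forms by induction. The norm bound is quantified
    over [w] after [p]: a single normal form works for all dominating weights. *)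
Lemma mnm_normal_form F G :
  (forall m, m \in F -> lead_witness m (G m)) ->
  (forall m, lead_mnm m -> exists2 m', m' \in F & lem m' m) ->
  forall m, exists p, [/\ J ('X_[m] - p),
    forall m', m' \in msupp p -> ~ lead_mnm m',
    forall m', m' \in msupp p -> m' = m \/ lexlt m' m &
    forall w, dominates w F G -> wnorm w p <= wmon w m].
Proof.
move=> FG Fdiv; elim/lexlt_ind => a IH.
have [alead|anlead] := pselect (lead_mnm a); last first.
  exists 'X_[a]; split.
  - by rewrite subrr.
  - by move=> m'; rewrite msuppX inE => /eqP ->.
  - by move=> m'; rewrite msuppX inE => /eqP ->; left.
  - by move=> w _; rewrite wnormX.
have [m mF ma] := Fdiv a alead; have [JG Gm Glt] := FG m mF.
pose b := mnm_sub a m; have ba : mnm_add b m = a by exact: submK.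
(* The value 0 outside the tail of [G m] is a default that makes the choice function total. *)
have NPex m' : exists p, m' \in msupp (G m) -> m' != m ->
  [/\ J ('X_[mnm_add b m'] - p),
    forall m0, m0 \in msupp p -> ~ lead_mnm m0,
    forall m0, m0 \in msupp p -> m0 = mnm_add b m' \/ lexlt m0 (mnm_add b m') &
    forall w, dominates w F G -> wnorm w p <= wmon w (mnm_add b m')].
  have [[m'G m'm]|nm'] := pselect (m' \in msupp (G m) /\ m' != m); last first.
    by exists 0 => m'G m'm; case: nm'.
  have ltm' : lexlt m' m.
    by have [mm|//] := Glt _ m'G; rewrite mm eqxx in m'm.
  have := lexlt_add2l b ltm'; rewrite ba => /IH[p pP].
  by exists p.
have [N NP] := choice NPex.
exists (\sum_(m' <- msupp (G m) | m' != m) - (G m)@_m' *: N m'); split.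
(* Both terms on the right lie in [J]: a multiple of [G m], and the errors of the reductions of the
   tail. *)
- have -> : 'X_[a] - \sum_(m' <- msupp (G m) | m' != m) - (G m)@_m' *: N m' =
     'X_[b] * G m - \sum_(m' <- msupp (G m) | m' != m)
       (G m)@_m' *: ('X_[mnm_add b m'] - N m').
    rewrite {3}[G m]mpolyE mulr_sumr.
    have mG : m \in msupp (G m) by rewrite mcoeff_msupp Gm oner_neq0.
    rewrite (bigD1_seq m) ?msupp_uniq//= Gm scale1r -mpolyXD ba -addrA.
    congr (_ + _); rewrite -sumrN -sumrB; apply: eq_bigr => m' _.
    rewrite scaleNr opprK -scalerAr -mpolyXD scalerBr opprB addrCA subrr.
    by rewrite addr0.
  apply: JB; first exact: JM.
  by apply: Jsum => m' m'G m'm; apply: JZ; have [] := NP _ m'G m'm.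
- move=> m0 /mem_msupp_sum[m' [m'G m'm] /msuppZ_le].
  by have [_ + _ _] := NP _ m'G m'm; apply.
- move=> m0 /mem_msupp_sum[m' [m'G m'm] /msuppZ_le].
  have [_ _ + _] := NP _ m'G m'm => /[apply].
  have ltm' : lexlt m' m.
    by have [mm|//] := Glt _ m'G; rewrite mm eqxx in m'm.
  have := lexlt_add2l b ltm'; rewrite ba => lta [->|lt0]; right => //.
  exact: lexlt_trans lta.
- move=> w wdom; have [w0 wF] := wdom.
  apply: le_trans (ler_wnorm_sum w0 _ _ _) _.
  rewrite -ba wmonD; apply: le_trans (ler_wpM2l (wmon_ge0 b w0) (wF m mF)).
  rewrite mulr_sumr big_seq_cond [leRHS]big_seq_cond.
  apply: ler_sum => m' /andP[m'G m'm].
  rewrite wnormZ normrN mulrCA -wmonD ler_wpM2l//.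
  by have [_ _ _] := NP _ m'G m'm; apply.
Qed.

End NormalForm.

Section LinearExtension.
Import -(notations) mpoly.
Variables (R : realFieldType) (k : nat) (V : lmodType R) (N : multinom k -> V).
Local Notation "p @_ m" := (mcoeff m p) (at level 2, m at level 2).
Implicit Types (p q : mpoly k R) (m : multinom k).

Definition mlin p : V := \sum_(m <- msupp p) p@_m *: N m.

Lemma mlin_sup p (s : seq (multinom k)) : uniq s ->
  {subset msupp p <= s} -> mlin p = \sum_(m <- s) p@_m *: N m.
Proof.
move=> us ps; apply: sum_msupp_sup => // m ->.
by rewrite scale0r.
Qed.

Lemma mlin_is_linear : linear mlin.
Proof.
move=> c p q; pose s := undup (msupp p ++ msupp q).
have us : uniq s by exact: undup_uniq.
have ps : {subset msupp p <= s} by move=> m mp; rewrite mem_undup mem_cat mp.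
have qs : {subset msupp q <= s}.
  by move=> m mq; rewrite mem_undup mem_cat mq orbT.
rewrite (mlin_sup us ps) (mlin_sup us qs) (@mlin_sup _ s)//; last first.
  move=> m /msuppD_le; rewrite mem_undup !mem_cat.
  by case/orP => [/msuppZ_le ->|->]; rewrite ?orbT.
rewrite scaler_sumr -big_split; apply: eq_bigr => m _ /=.
by rewrite mcoeffD mcoeffZ scalerDl scalerA.
Qed.

HB.instance Definition _ := GRing.isLinear.Build R (mpoly k R) V _ mlin
  mlin_is_linear.

Lemma mlinX m : mlin (mpolyX R m) = N m.
Proof. by rewrite /mlin msuppX big_seq1 mcoeffX eqxx scale1r. Qed.

End LinearExtension.

(** * Norms under substitution, and the bounded lift along the generators *)

Section CompNorm.
Import -(notations) mpoly.
Variables (R : realFieldType) (k l : nat).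

Lemma ler_wnorm_comp (w : 'I_k -> R) (v : 'I_l -> R)
    (lq : k.-tuple (mpoly l R)) (p : mpoly k R) :
  (forall i, 0 <= v i) -> (forall i, wnorm v (tnth lq i) <= w i) ->
  wnorm v (comp_mpoly lq p) <= wnorm w p.
Proof.
move=> v0 vw; rewrite comp_mpolyEX.
apply: le_trans (ler_wnorm_sum v0 _ _ _) _.
apply: ler_sum => m _; rewrite wnormZ ler_wpM2l// comp_mpolyX.
apply: (ler_wnorm_prod v0) => i _.
by rewrite (le_trans (ler_wnormX v0 _ _))// lerXn2r// nnegrE
  ?(le_trans _ (vw i)) ?wnorm_ge0.
Qed.

End CompNorm.

Section BoundedLift.
Import -(notations) mpoly.
Variables (R : realFieldType) (n l : nat) (rho : l.-tuple (mpoly n R)).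
Local Notation "p @_ m" := (mcoeff m p) (at level 2, m at level 2).
Local Notation "''X_[' m ]" := (mpolyX R m).

(** Substitution of $\rho_j(x)$ for $t_j$. Its kernel is the ideal of the graph of $\rho$ and serves
    as its definition. The variables x come first, hence are the larger ones for the lexicographic
    order. *)
Let Ex : (n + l).-tuple (mpoly n R) :=
  [tuple match fintype.split i with inl j => 'X_[mnm1 j] | inr j => tnth rho j end
  | i < n + l].
(** Restriction to x = 0. It does not increase norms when the weights of the $t_j$ are at least [r],
    which is why weights bounded below by [r] are asked for. *)
Let res : (n + l).-tuple (mpoly l R) :=
  [tuple match fintype.split i with inl _ => 0 | inr j => 'X_[mnm1 j] end | i < n + l].
Let embx (a : multinom n) : multinom (n + l) :=
  Multinom [tuple match fintype.split i with inl j => a j | inr _ => 0%N end | i < n + l].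
Let embt (b : multinom l) : multinom (n + l) :=
  Multinom [tuple match fintype.split i with inl _ => 0%N | inr j => b j end | i < n + l].

Let splitl (j : 'I_n) : fintype.split (lshift l j) = inl j.
Proof. exact: (unsplitK (inl j)). Qed.
Let splitr (j : 'I_l) : fintype.split (rshift n j) = inr j.
Proof. exact: (unsplitK (inr j)). Qed.

Let Ex_embx a : comp_mpoly Ex 'X_[embx a] = 'X_[a].
Proof.
rewrite comp_mpolyX big_split_ord/= [X in _ * X]big1 ?mulr1; last first.
  by move=> j _; rewrite multinomE tnth_mktuple splitr expr0.
rewrite mpolyXE_id; apply: eq_bigr => j _.
by rewrite multinomE !tnth_mktuple splitl.
Qed.

Let Ex_embt b : comp_mpoly Ex 'X_[embt b] = comp_mpoly rho 'X_[b].
Proof.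
rewrite !comp_mpolyX big_split_ord/= [X in X * _]big1 ?mul1r; last first.
  by move=> j _; rewrite multinomE tnth_mktuple splitl expr0.
by apply: eq_bigr => j _; rewrite multinomE !tnth_mktuple splitr.
Qed.

Let xfree (m : multinom (n + l)) := forall j : 'I_n, m (lshift l j) = 0%N.

Let Ex_xfree m : xfree m ->
  comp_mpoly Ex 'X_[m] = comp_mpoly rho (comp_mpoly res 'X_[m]).
Proof.
move=> xm; rewrite !comp_mpolyX !big_split_ord/=.
rewrite [X in X * _ = _]big1 ?mul1r; last by move=> j _; rewrite xm expr0.
rewrite [X in comp_mpoly _ (X * _)]big1 ?mul1r; last first.
  by move=> j _; rewrite xm expr0.
rewrite rmorph_prod; apply: eq_bigr => j _; rewrite rmorphXn/=; congr (_ ^+ _).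
by rewrite !tnth_mktuple splitr comp_mpolyXU -tnth_nth.
Qed.

(* In the lexicographic order a monomial in the last l variables only dominates
   monomials in the last l variables, so that the normal form of a polynomial
   of R[rho] modulo the ideal of the graph of rho involves no x. *)
Let xfree_lexlt b m : m = embt b \/ lexlt m (embt b) -> xfree m.
Proof.
have embt0 j : embt b (lshift l j) = 0%N.
  by rewrite multinomE tnth_mktuple splitl.
move=> [-> j|[i eqi lti] j]; first exact: embt0.
rewrite -[RHS](embt0 j); apply: eqi; move: lti.
have := splitK i; case: (fintype.split i) => i' /= <-; first by rewrite embt0.
by move=> _; rewrite (leq_trans (ltn_ord j))// leq_addr.
Qed.

Let comp_mlin j j' j'' (lq : j.-tuple (mpoly j' R)) (N : multinom j'' -> mpoly j R) p :
  comp_mpoly lq (mlin N p) = mlin (fun m => comp_mpoly lq (N m)) p.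
Proof.
by rewrite /mlin linear_sum; apply: eq_bigr => m _; rewrite linearZ.
Qed.

Let mlin_id j (p : mpoly j R) : mlin (mpolyX R) p = p.
Proof. by rewrite [RHS]mpolyE. Qed.

Let eq_mlin j (V : lmodType R) (N N' : multinom j -> V) p :
  {in msupp p, N =1 N'} -> mlin N p = mlin N' p.
Proof.
move=> NN'; rewrite /mlin big_seq_cond [RHS]big_seq_cond.
by apply: eq_bigr => m /andP[mp _]; rewrite NN'.
Qed.

Lemma bounded_lift : exists L : multinom n -> mpoly l R,
  (forall r : R, 0 <= r -> exists2 C, 0 <= C &
     forall a, wnorm (fun=> r) (L a) <= C ^+ mdeg a) /\
  forall q, let f := comp_mpoly rho q in comp_mpoly rho (mlin L f) = f.
Proof.
pose J p := comp_mpoly Ex p = 0.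
have J0 : J 0 by rewrite /J comp_mpoly0.
have JD p q : J p -> J q -> J (p + q) by rewrite /J comp_mpolyD => -> ->; rewrite addr0.
have JM p q : J q -> J (p * q) by rewrite /J rmorphM/= => ->; rewrite mulr0.
have [F [G [FG Fdiv wP]]] := lead_basis J.
have [N NP] := choice (mnm_normal_form J0 JD JM FG Fdiv).
have ExN m : comp_mpoly Ex (N m) = comp_mpoly Ex 'X_[m].
  by have [+ _ _ _] := NP m; rewrite /J comp_mpolyB => /eqP; rewrite subr_eq0 => /eqP.
exists (fun a => comp_mpoly res (N (embx a))); split=> [r r0|q f].
  (* The sum of the weights is a common bound for the weights of the variables x, so the weight of
     $x^a$ is at most its power of exponent $|a|$. *)
  have [w [wr [w0 wF]]] := wP r; exists (\sum_i w i) => [|a].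
    by rewrite sumr_ge0.
  apply: (@le_trans _ _ (wnorm w (N (embx a)))).
    apply: ler_wnorm_comp => // i; rewrite tnth_mktuple.
    by case: (fintype.split i) => j; rewrite ?wnorm0// wnormX wmonU.
  have [_ _ _ /(_ w)] := NP (embx a); move/(_ (conj w0 wF))/le_trans; apply.
  rewrite /wmon big_split_ord/= [X in _ * X]big1 ?mulr1; last first.
    by move=> j _; rewrite multinomE tnth_mktuple splitr expr0.
  rewrite mdegE -prodrXr; apply: ler_prod => j _.
  rewrite multinomE tnth_mktuple splitl exprn_ge0//= lerXn2r ?nnegrE ?sumr_ge0//.
  by rewrite (bigD1 (lshift l j))//= lerDl sumr_ge0.
(* Two normal forms of [f]: one computed from its monomials in x, the other from [q] read as a
   polynomial in t. Their difference lies in the ideal and has no leading monomial, so they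
   coincide; and [P2] is free of x. *)
pose P1 := mlin (fun a => N (embx a)) f.
pose P2 := mlin (fun b => N (embt b)) q.
have ExP1 : comp_mpoly Ex P1 = f.
  rewrite comp_mlin -[RHS]mlin_id; apply: eq_mlin => a _.
  by rewrite ExN Ex_embx.
have ExP2 : comp_mpoly Ex P2 = f.
  rewrite comp_mlin /f -[in RHS](mlin_id q) comp_mlin; apply: eq_mlin => b _.
  by rewrite ExN Ex_embt.
rewrite -comp_mlin -/P1.
have -> : P1 = P2.
  apply/eqP; rewrite -subr_eq0; apply/eqP.
  apply: (no_lead_mnm_eq0 JM) => [|m]; first by rewrite /J comp_mpolyB ExP1 ExP2 subrr.
  move=> /msuppB_le; rewrite mem_cat.
  by case/orP => /mem_msupp_sum[m' _ /msuppZ_le];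
     [have [_ + _ _] := NP (embx m')|have [_ + _ _] := NP (embt m')]; apply.
rewrite -[RHS]ExP2 !comp_mlin; apply: eq_mlin => b _.
rewrite -[N (embt b)]mlin_id !comp_mlin; apply: eq_mlin => m mN.
rewrite -Ex_xfree//; apply: (@xfree_lexlt b).
by have [_ _ /(_ _ mN)] := NP (embt b).
Qed.

End BoundedLift.

(** * Series of polynomials with geometric decay *)

Section GeometricBound.
Variable R : realType.
Implicit Types (u v : R^nat) (D : R).

Definition geo_bounded D u := forall m, `|u m| <= D / 2 ^+ m.

Lemma geo_bounded_ge0 D u : geo_bounded D u -> 0 <= D.
Proof.
by move=> /(_ 0%N); rewrite expr0 divr1; exact: le_trans (normr_ge0 _).
Qed.

Lemma geo_bounded_cvg D u : geo_bounded D u -> cvgn (series u).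
Proof.
move=> uD; apply: normed_cvg.
apply: (@series_le_cvg _ _ (geometric D 2^-1)) => [n|n|n|].
- exact: normr_ge0.
- by rewrite geometric_ge0// ?(geo_bounded_ge0 uD)// invr_ge0.
- by rewrite /geometric/= exprVn.
- by apply: is_cvg_geometric_series; rewrite ger0_norm// invf_lt1// ltr1n.
Qed.

Lemma geo_bounded_tail D u M : geo_bounded D u ->
  `|limn (series u) - series u M| <= 2 * D / 2 ^+ M.
Proof.
move=> uD; have D0 := geo_bounded_ge0 uD.
(* The right-hand side is the exact geometric partial sum, so the induction step is an equality. *)
have tailN k :
    `|series u (M + k)%N - series u M| <= (2 * D - 2 * D / 2 ^+ k) / 2 ^+ M.
  elim: k => [|k IH].
    by rewrite addn0 subrr normr0 expr0 divr1 subrr mul0r.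
  rewrite addnS seriesSr addrAC (le_trans (ler_normD _ _))//.
  rewrite (le_trans (lerD IH (uD _)))// exprD exprS.
  have p0 : (2 ^+ k : R) != 0 by rewrite expf_neq0.
  have q0 : (2 ^+ M : R) != 0 by rewrite expf_neq0.
  by rewrite le_eqVlt; apply/orP; left; apply/eqP; field; rewrite p0 q0.
have cu : `|series u n - series u M| @[n --> \oo] -->
    `|limn (series u) - series u M|.
  by apply: cvg_norm; apply: cvgB; [exact: geo_bounded_cvg uD|exact: cvg_cst].
rewrite -(cvg_lim _ cu)//; apply: limr_le; first exact: cvgP cu.
exists M => // n /= Mn; rewrite -(subnKC Mn) (le_trans (tailN _))//.
by rewrite ler_pM2r ?invr_gt0 ?exprn_gt0// gerBl mulr_ge0 ?invr_ge0 ?exprn_ge0 ?mulr_ge0.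
Qed.

Lemma geo_bounded_lim D u : geo_bounded D u -> `|limn (series u)| <= 2 * D.
Proof.
by move=> /(geo_bounded_tail 0); rewrite {2}/series/= big_geq// subr0 expr0 divr1.
Qed.

Lemma geo_boundedB D D' u v : geo_bounded D u -> geo_bounded D' v ->
  geo_bounded (D + D') (fun m => u m - v m).
Proof.
by move=> uD vD m; rewrite mulrDl (le_trans (ler_normB _ _))// lerD.
Qed.

Lemma geo_boundedZ D c u : geo_bounded D u ->
  geo_bounded (`|c| * D) (fun m => c * u m).
Proof. by move=> uD m; rewrite normrM -mulrA ler_wpM2l. Qed.

Lemma lim_geo_boundedZ D c u : geo_bounded D u ->
  limn (series (fun m => c * u m)) = c * limn (series u).
Proof. by move=> /geo_bounded_cvg uD; exact: (lim_seriesZ c uD). Qed.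

Lemma lim_geo_boundedD D D' u v : geo_bounded D u -> geo_bounded D' v ->
  limn (series (fun m => u m + v m)) = limn (series u) + limn (series v).
Proof.
by move=> /geo_bounded_cvg uD /geo_bounded_cvg vD; exact: (lim_seriesD uD vD).
Qed.

Lemma lim_geo_boundedB D D' u v : geo_bounded D u -> geo_bounded D' v ->
  limn (series (fun m => u m - v m)) = limn (series u) - limn (series v).
Proof.
by move=> /geo_bounded_cvg uD /geo_bounded_cvg vD; exact: (lim_seriesB uD vD).
Qed.

Lemma lim_geo_bounded_sum (I : Type) (s : seq I) (u : I -> R^nat) (D : I -> R) :
  (forall i, geo_bounded (D i) (u i)) ->
  limn (series (fun m => \sum_(i <- s) u i m)) =
  \sum_(i <- s) limn (series (u i)).
Proof.
move=> uD; have sD r : geo_bounded (\sum_(i <- r) D i) (fun m => \sum_(i <- r) u i m).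
  move=> m; rewrite mulr_suml (le_trans (ler_norm_sum _ _ _))//.
  by apply: ler_sum => i _; exact: uD.
elim: s => [|i s IH].
  rewrite big_nil; under eq_fun do rewrite big_nil.
  by apply/eqP; rewrite -normr_le0 (le_trans (@geo_bounded_lim 0 _ _)) ?mulr0// => m;
    rewrite normr0 mul0r.
rewrite big_cons -IH -(lim_geo_boundedD (uD i) (sD s)).
by congr (limn (series _)); apply/funext => m; rewrite big_cons.
Qed.

End GeometricBound.

(** * Taylor expansion of polynomials, with norm estimates *)

Section Taylor.
Import -(notations) mpoly.
Variables (R : realFieldType) (l : nat).
Local Notation "p @_ m" := (mcoeff m p) (at level 2, m at level 2).
Implicit Types (p q : mpoly l R) (a u v : 'I_l -> R).

Lemma mpoly_subalg_ind (P : mpoly l R -> Prop) :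
  (forall c, P (mpolyC l c)) -> (forall p q, P p -> P q -> P (p + q)) ->
  (forall p q, P p -> P q -> P (p * q)) -> (forall i, P (mpolyX R (mnm1 i))) ->
  forall p, P p.
Proof.
move=> PC PD PM PX p; rewrite [p]mpolyE; elim/big_rec: _ => [|m q _ Pq].
  by rewrite -(mpolyC0 l R).
suff Pm : P (mpolyX R m).
  by apply: (PD _ _ _ Pq); rewrite -mul_mpolyC; exact: (PM _ _ (PC _) Pm).
rewrite mpolyXE_id; elim/big_rec: _ => [|i r _ Pr]; first exact: PC.
apply: (PM _ _ _ Pr); elim: (m i) => [|j IH]; first by rewrite expr0; exact: PC.
by rewrite exprS; exact: (PM _ _ (PX i) IH).
Qed.

Definition mshift a : mpoly l R -> mpoly l R :=
  comp_mpoly [tuple mpolyX R (mnm1 i) + mpolyC l (a i) | i < l].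

Lemma meval_mshift a u p : meval u (mshift a p) = meval (fun i => a i + u i) p.
Proof.
rewrite /mshift comp_mpoly_meval; apply: meval_eq => i.
by rewrite tnth_mktuple mevalD mevalXU mevalC addrC.
Qed.

Lemma wnorm_mshift a p (r b : R) : 0 <= r -> (forall i, `|a i| <= b) ->
  wnorm (fun=> r) (mshift a p) <= wnorm (fun=> r + b) p.
Proof.
move=> r0 ab; apply: ler_wnorm_comp => // i; rewrite tnth_mktuple.
by rewrite (le_trans (ler_wnormD _ _ _))// wnormX wmonU wnormC lerD2l.
Qed.

Lemma mderiv_mshift a i p : mderiv i (mshift a p) = mshift a (mderiv i p).
Proof.
elim/mpoly_subalg_ind: p => [c|p q IHp IHq|p q IHp IHq|j].
- by rewrite /mshift comp_mpolyC !mderivC comp_mpoly0.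
- by rewrite /mshift comp_mpolyD !mderivD comp_mpolyD; congr (_ + _).
- rewrite /mshift rmorphM/= !mderivM rmorphD !rmorphM/=.
  by congr (_ * _ + _ * _).
- rewrite /mshift comp_mpolyXU -tnth_nth tnth_mktuple mderivD mderivC addr0.
  rewrite !mderivX comp_mpolyZ; have [->|ji] := eqVneq j i.
    have -> : mnm_sub (mnm1 i) (mnm1 i) = @mnm0 l.
      by apply/mnmP => j'; rewrite mnmBE subnn mnm0E.
    by rewrite mpolyX0 comp_mpoly1.
  by rewrite mnm1E (negbTE ji) !scale0r.
Qed.

Lemma mcoeff_meval0 p : p@_(@mnm0 l) = meval (fun=> 0) p.
Proof.
rewrite mevalE [in LHS](mpolyE p) raddf_sum; apply: eq_bigr => m _ /=.
rewrite mcoeffZ mcoeffX; congr (_ * _); have [->|m0] := eqVneq m.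
  by rewrite big1// => i _; rewrite mnm0E expr0.
have [i mi] : exists i, m i != 0%N.
  apply/existsP; apply: contraNT m0; rewrite negb_exists => /forallP m0.
  by apply/eqP/mnmP => i; rewrite mnm0E; have := m0 i; rewrite negbK => /eqP.
by rewrite (bigD1 i)//= expr0n (negbTE mi) mul0r.
Qed.

Lemma mcoeff0_mshift a p : (mshift a p)@_(@mnm0 l) = meval a p.
Proof.
by rewrite mcoeff_meval0 meval_mshift; apply: meval_eq => i; rewrite addr0.
Qed.

Lemma mcoeffU_mshift a i p : (mshift a p)@_(mnm1 i) = meval a (mderiv i p).
Proof.
rewrite -mcoeff0_mshift -mderiv_mshift mcoeff_deriv.
by rewrite mnm0E mulr1n add0m.
Qed.

(** On monomials this amounts to $d\,r^{d-1} \le (r+1)^d$. The loss of radius is harmless for series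
    controlled at every radius. *)
Lemma wnorm_mderiv (r : R) i p : 0 <= r ->
  wnorm (fun=> r) (mderiv i p) <= wnorm (fun=> r + 1) p.
Proof.
move=> r0; rewrite [X in mderiv _ X]mpolyE linear_sum.
apply: le_trans (ler_wnorm_sum _ _ _ _) _ => //.
apply: ler_sum => m _; rewrite linearZ wnormZ ler_wpM2l//= mderivX wnormZ wnormX.
rewrite !wmon_const normr_nat; have [->|mi] := eqVneq (m i) 0%N.
  by rewrite mul0r exprn_ge0// addr_ge0.
have m1 : lem (mnm1 i) m by rewrite lep1mP.
have := submK m1; set m' := mnm_sub _ _ => mE.
rewrite -{2}mE mdegD mdeg1 addn1 (@le_trans _ _ ((mdeg m').+1%:R * r ^+ mdeg m'))//.
  rewrite ler_wpM2r ?exprn_ge0// ler_nat -{1}mE mnmDE mnm1E eqxx addn1 ltnS.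
  by rewrite mdegE (bigD1 i)//= leq_addr.
elim: (mdeg m') => [|k IH]; first by rewrite !expr0 expr1 mulr1 lerDr.
rewrite exprS mulrCA [leRHS]exprSr mulrDr mulr1 -addn1 natrD mulrDl mul1r mulrDr.
rewrite lerD//; first by rewrite mulrC ler_wpM2r.
by rewrite -exprS lerXn2r ?nnegrE ?addr_ge0// lerDl.
Qed.

End Taylor.

Section TaylorEstimates.
Import -(notations) mpoly.
Variables (R : realFieldType) (l : nat).
Local Notation "p @_ m" := (mcoeff m p) (at level 2, m at level 2).
Implicit Types (p q : mpoly l R) (u : 'I_l -> R).

Lemma mcoeff_sum_msupp q m0 : q@_m0 = \sum_(m <- msupp q) q@_m * (m == m0)%:R.
Proof.
rewrite [in LHS](mpolyE q) raddf_sum; apply: eq_bigr => m _ /=.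
by rewrite mcoeffZ mcoeffX.
Qed.

Lemma mnm_neq0 (m : multinom l) : m != @mnm0 l -> exists i, (0 < m i)%N.
Proof.
move=> m0; apply/existsP; apply: contraNT m0; rewrite negb_exists => /forallP m0.
by apply/eqP/mnmP => i; rewrite mnm0E; have := m0 i; rewrite lt0n negbK => /eqP.
Qed.

Lemma meval_sub_mcoeff0 q u (e : R) : 0 <= e <= 1 -> (forall i, `|u i| <= e) ->
  `|meval u q - q@_(@mnm0 l)| <= e * wnorm (fun=> 1) q.
Proof.
move=> /andP[e0 e1] ue; rewrite (mcoeff_sum_msupp q) mevalE -sumrB.
rewrite (le_trans (ler_norm_sum _ _ _))// mulr_sumr; apply: ler_sum => m _.
rewrite -mulrBr normrM [leRHS]mulrCA ler_wpM2l// wmon_const expr1n mulr1.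
have [->|m0] := eqVneq m.
  by rewrite big1 ?subrr ?normr0// => i _; rewrite mnm0E expr0.
have [i mi] := mnm_neq0 m0; rewrite subr0 normr_prod (bigD1 i)//=.
rewrite -[leRHS]mulr1; apply: ler_pM => //; first by rewrite prodr_ge0.
  rewrite normrX -(prednK mi) exprS -[leRHS]mulr1 ler_pM ?exprn_ge0//.
  by rewrite exprn_ile1// (le_trans (ue i)).
apply: prodr_ile1 => j; rewrite normr_ge0/= normrX exprn_ile1//.
by rewrite (le_trans (ue j)).
Qed.

(** Second-order remainder along an axis, with a constant linear in the norm of [q] so that it can
    be summed over a series. A monomial involving another variable vanishes on the axis; a power of
    the i-th variable of exponent at least 2 contributes at most $h^2$. *)
Lemma meval_axis q (i : 'I_l) (h : R) : `|h| <= 1 ->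
  `|meval (fun j => h * (j == i)%:R) q - q@_(@mnm0 l) - h * q@_(mnm1 i)|
    <= h ^+ 2 * wnorm (fun=> 1) q.
Proof.
move=> h1; rewrite (mcoeff_sum_msupp q) (mcoeff_sum_msupp q (mnm1 i)).
rewrite mevalE mulr_sumr -!sumrB.
rewrite (le_trans (ler_norm_sum _ _ _))// mulr_sumr; apply: ler_sum => m _.
rewrite mulrCA -!mulrBr normrM [leRHS]mulrCA ler_wpM2l// wmon_const expr1n mulr1.
have h20 : 0 <= h ^+ 2 by rewrite sqr_ge0.
have [j /andP[ji mj]|noj] := pickP (fun j => (j != i) && (0 < m j)%N).
  rewrite (bigD1 j)//= (negbTE ji) mulr0 expr0n (gtn_eqF mj) mul0r.
  have [m0|_] := eqVneq m; first by rewrite m0 mnm0E in mj.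
  have [mi|_] := eqVneq m; first by rewrite mi mnm1E eq_sym (negbTE ji) in mj.
  by rewrite mulr0 !subr0 normr0.
have m0 j : j != i -> m j = 0%N.
  by move=> ji; have := noj j; rewrite ji lt0n => /negbFE/eqP.
rewrite (bigD1 i)//= big1 ?mulr1 => [|j ji]; last by rewrite m0.
rewrite eqxx mulr1.
have -> : (m == @mnm0 l) = (m i == 0%N).
  apply/eqP/eqP => [->|mi]; first by rewrite mnm0E.
  by apply/mnmP => j; rewrite mnm0E; have [->//|/m0] := eqVneq j i.
have -> : (m == mnm1 i) = (m i == 1%N).
  apply/eqP/eqP => [->|mi]; first by rewrite mnm1E eqxx.
  by apply/mnmP => j; rewrite mnm1E; have [<-|ji] := eqVneq i j;
     rewrite ?mi// m0// eq_sym.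
case: (m i) => [|[|k]] /=.
- by rewrite expr0 mulr0 subr0 subrr normr0.
- by rewrite expr1 mulr1 subr0 subrr normr0.
rewrite mulr0 !subr0 normrX -addn2 exprD -(normr_idP h20) normrX ler_piMl ?exprn_ge0//.
by rewrite exprn_ile1.
Qed.

End TaylorEstimates.

(** * Continuity and derivatives of entire series of polynomials *)

Section EntireSeries.
Variables (R : realType) (l : nat).
Local Notation "p @_ m" := (mpoly.mcoeff m p) (at level 2, m at level 2).
Implicit Types (p : nat -> mpoly.mpoly l R) (a x : 'cV[R]_l).

(** The polynomials need not be homogeneous, so this is not a power series yet. A bound at every
    radius allows translations and derivatives, which enlarge the radius. *)
Definition entire p := forall r : R, 0 <= r ->
  exists D, forall m, wnorm (fun=> r) (p m) <= D / 2 ^+ m.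

Definition polysum p x : R := limn (series (fun m => peval (p m) x)).

Lemma near_coord a (e : R) : 0 < e ->
  \forall x \near a, forall i, `|(x - a) i ord0| <= e.
Proof.
move=> e0; apply/nbhs_ballP; exists e => //= x [_ ax] i.
by rewrite !mxE distrC; apply/ltW; exact: (ax i ord0).
Qed.

Let cv0 x : 'I_l -> R := fun i => x i ord0.

Definition shift_seq a p : nat -> mpoly.mpoly l R := fun m => mshift (cv0 a) (p m).

Lemma entire_shift a p : entire p -> entire (shift_seq a p).
Proof.
move=> ep r r0; have [|D pD] := ep (r + \sum_i `|a i ord0|).
  by rewrite addr_ge0// sumr_ge0.
exists D => m; apply: le_trans (pD m).
apply: wnorm_mshift => // i; rewrite /cv0 (bigD1 i)//= lerDl.
by rewrite sumr_ge0.
Qed.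

Lemma entire_mderiv i p : entire p -> entire (fun m => mpoly.mderiv i (p m)).
Proof.
move=> ep r r0; have [|D pD] := ep (r + 1); first by rewrite addr_ge0.
by exists D => m; rewrite (le_trans (wnorm_mderiv _ _ _)).
Qed.

Lemma entire_geo p x : entire p ->
  exists D, geo_bounded D (fun m => peval (p m) x).
Proof.
move=> ep; have [|D pD] := ep (\sum_i `|x i ord0|); first by rewrite sumr_ge0.
exists D => m; apply: le_trans (pD m); apply: ler_norm_meval => i.
  by rewrite sumr_ge0.
by rewrite (bigD1 i)//= lerDl sumr_ge0.
Qed.

Lemma peval_shift a p m x : peval (p m) (a + x) = peval (shift_seq a p m) x.
Proof.
rewrite /peval /shift_seq meval_mshift; apply: mpoly.meval_eq => i.
by rewrite mxE.
Qed.

Lemma entire_continuous p : entire p -> continuous (polysum p).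
Proof.
move=> ep a; have [D qD] := entire_shift a ep ler01.
have D0 : 0 <= D.
  have := qD 0%N; rewrite expr0 divr1; apply: le_trans.
  by apply: wnorm_ge0 => i; exact: ler01.
apply/(@cvgrPdist_le _ _ _ (nbhs a) (nbhs_filter a)) => /= e e0.
(* The factor 2 comes from summing the geometric bound; the added 1 covers the case where [D] is
   0. *)
pose d := Num.min 1 (e / (2 * D + 1)).
have d0 : 0 < d by rewrite lt_min ltr01 divr_gt0// ltr_wpDl// mulr_ge0.
have d01 : 0 <= d <= 1 by rewrite ltW//= ge_min lexx.
near=> x.
have xd : forall i, `|(x - a) i ord0| <= d.
  by near: x; exact: near_coord.
have [Dx pDx] := entire_geo x ep; have [Da pDa] := entire_geo a ep.
rewrite /polysum -(lim_geo_boundedB pDa pDx).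
apply: (@le_trans _ _ (2 * (d * D))); last first.
  rewrite mulrCA.
  rewrite (@le_trans _ _ (e / (2 * D + 1) * (2 * D)))//.
    by rewrite ler_wpM2r ?mulr_ge0// ge_min lexx orbT.
  rewrite mulrAC ler_pdivrMr ?ltr_wpDl ?mulr_ge0// ler_pM2l//.
  by rewrite lerDl.
apply: geo_bounded_lim => m.
rewrite distrC -[x](subrKC a) peval_shift -mulrA.
apply: (@le_trans _ _ (d * wnorm (fun=> 1) (shift_seq a p m))); last first.
  by rewrite ler_wpM2l// ltW.
apply: le_trans (meval_sub_mcoeff0 _ d01 xd).
by rewrite mcoeff0_mshift.
Unshelve. all: end_near. Qed.

(** The error of the difference quotient, multiplied by [h], is itself a series whose m-th term is
    at most $h^2 D/2^m$ by the second-order estimate at [a]; its sum is at most $2h^2D$. *)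
Lemma entire_derive p i a : entire p ->
  is_derive a (delta_mx i ord0 : 'cV[R]_l) (polysum p)
    (polysum (fun m => mpoly.mderiv i (p m)) a).
Proof.
move=> ep; have [D qD] := entire_shift a ep ler01.
have D0 : 0 <= D.
  have := qD 0%N; rewrite expr0 divr1; apply: le_trans.
  by apply: wnorm_ge0 => j; exact: ler01.
set df := polysum _ a; set v : 'cV[R]_l := delta_mx i ord0.
suff cvf : h^-1 *: ((polysum p \o shift a) (h *: v) - polysum p a)
    @[h --> 0^'] --> df.
  by apply: DeriveDef; [exact: cvgP cvf|exact: cvg_lim cvf].
apply/cvgrPdist_le => /= e e0; near=> h.
have h0 : h != 0 by near: h; exact: nbhs_dnbhs_neq.
have h1 : `|h| <= 1.
  by near: h; apply: dnbhs0_le.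
have he : `|h| * (2 * D) <= e.
  have : `|h| <= e / (2 * D + 1).
    near: h; apply: dnbhs0_le.
    by rewrite divr_gt0// ltr_wpDl// mulr_ge0.
  rewrite ler_pdivlMr ?ltr_wpDl ?mulr_ge0//; apply: le_trans.
  by rewrite ler_wpM2l// lerDl.
have [Dx pDx] := entire_geo (h *: v + a) ep; have [Da pDa] := entire_geo a ep.
have [Dd pDd] := entire_geo a (entire_mderiv i ep).
apply: le_trans he; rewrite -(ler_pM2l (_ : 0 < `|h|)) ?normr_gt0//.
rewrite -normrM mulrBr -[_ *: (_ - _)]/(_ * _) mulVKf//= distrC.
rewrite /df /polysum -(lim_geo_boundedB pDx pDa) -(lim_geo_boundedZ h pDd).
rewrite -(lim_geo_boundedB (geo_boundedB pDx pDa) (geo_boundedZ h pDd)).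
have -> : `|h| * (`|h| * (2 * D)) = 2 * (h ^+ 2 * D).
  by rewrite mulrA -expr2 real_normK ?num_real// mulrCA.
apply: geo_bounded_lim => m.
rewrite [h *: v + a]addrC peval_shift /= -mulrA.
apply: (@le_trans _ _ (h ^+ 2 * wnorm (fun=> 1) (shift_seq a p m))); last first.
  by rewrite ler_wpM2l// sqr_ge0.
apply: le_trans (meval_axis _ i h1).
rewrite mcoeff0_mshift mcoeffU_mshift le_eqVlt; apply/orP; left; apply/eqP.
congr (`|_ - _ - _|); apply: mpoly.meval_eq => j.
by rewrite !mxE eqxx andbT.
Unshelve. all: end_near. Qed.

Lemma entire_Ck p k : entire p -> Ck k (polysum p).
Proof.
elim: k p => [|k IH] p ep; first by split=> //; exact: entire_continuous.
split=> [|i e_i]; first exact: entire_continuous.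
split=> [x|]; first by have [] := entire_derive i x ep.
rewrite (_ : (fun x => _) = polysum (fun m => mpoly.mderiv i (p m))).
  exact: IH (entire_mderiv i ep).
apply/funext => x; exact: (@derive_val _ _ _ _ _ _ _ (entire_derive i x ep)).
Qed.

End EntireSeries.

(** * Real analyticity of entire series, by unordered summation *)

Section PowerSeries.
Import -(notations) mpoly.
Variables (R : realType) (l : nat).
Local Notation "p @_ m" := (mpoly.mcoeff m p) (at level 2, m at level 2).
Implicit Types (p : nat -> mpoly.mpoly l R) (a x : 'cV[R]_l).

Definition mnm_of_ffun (m : {ffun 'I_l -> nat}) : mpoly.multinom l :=
  mpoly.Multinom [tuple m i | i < l].

Definition ffun_of_mnm (m : mpoly.multinom l) : {ffun 'I_l -> nat} :=
  [ffun i => mpoly.fun_of_multinom m i].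

Lemma mnm_of_ffunE m i : mpoly.fun_of_multinom (mnm_of_ffun m) i = m i.
Proof. by rewrite mpoly.multinomE tnth_mktuple. Qed.

Lemma mnm_of_ffunK : cancel mnm_of_ffun ffun_of_mnm.
Proof. by move=> m; apply/ffunP => i; rewrite ffunE mnm_of_ffunE. Qed.

Lemma ffun_of_mnmK : cancel ffun_of_mnm mnm_of_ffun.
Proof.
by move=> m; apply/mpoly.mnmP => i; rewrite mnm_of_ffunE ffunE.
Qed.

Lemma ler_sum_subset (I : eqType) (s s' : seq I) (F : I -> R) :
  uniq s -> uniq s' -> {subset s' <= s} -> (forall i, 0 <= F i) ->
  \sum_(i <- s') F i <= \sum_(i <- s) F i.
Proof.
move=> us us' ss F0; rewrite [leRHS](bigID (mem s'))/=.
have ps : perm_eq [seq i <- s | i \in s'] s'.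
  apply: uniq_perm => //; first exact: filter_uniq.
  by move=> i; rewrite mem_filter andb_idr// => /ss.
by rewrite -[X in _ <= X + _]big_filter (perm_big _ ps)/= lerDl sumr_ge0.
Qed.

Let pw x m : R := wmon (fun i => x i ord0) m.

Lemma peval_sup (q : mpoly.mpoly l R) x (s : seq (mpoly.multinom l)) :
  uniq s -> {subset mpoly.msupp q <= s} ->
  peval q x = \sum_(m <- s) q@_m * pw x m.
Proof.
move=> us qs; rewrite -[RHS](mlin_sup (V := R^o) (pw x) us qs).
by rewrite /peval mpoly.mevalE.
Qed.

Lemma ler_norm_partial (q : mpoly.mpoly l R) x (s : seq (mpoly.multinom l)) :
  uniq s -> (forall i, `|x i ord0| <= 1) ->
  `|\sum_(m <- s) q@_m * pw x m| <= wnorm (fun=> 1) q.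
Proof.
move=> us x1; pose s' := undup (s ++ mpoly.msupp q).
rewrite (@wnorm_sup _ _ _ _ s') ?undup_uniq//; last first.
  by move=> m mq; rewrite mem_undup mem_cat mq orbT.
rewrite (le_trans (ler_norm_sum _ _ _))//.
apply: (@le_trans _ _ (\sum_(m <- s) `|q@_m| * wmon (fun=> 1) m)).
  apply: ler_sum => m _; rewrite normrM ler_wpM2l// normr_prod.
  apply: ler_prod => i _; rewrite normr_ge0/= normrX lerXn2r ?nnegrE//.
apply: ler_sum_subset => //; first exact: undup_uniq.
  by move=> m ms; rewrite mem_undup mem_cat ms.
by move=> m; rewrite mulr_ge0// wmon_ge0.
Qed.

Definition taylor_coef p a (m : {ffun 'I_l -> nat}) : R :=
  limn (series (fun k => (shift_seq a p k)@_(mnm_of_ffun m))).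

Lemma ltr_div_expn2 (C e : R) : 0 <= C -> 0 < e -> exists M, C / 2 ^+ M < e.
Proof.
move=> C0 e0; exists (Num.bound (C / e)).
rewrite ltr_pdivrMr ?exprn_gt0// mulrC -ltr_pdivrMr//.
apply: (@lt_le_trans _ _ (Num.bound (C / e))%:R).
  by rewrite archi_boundP// divr_ge0// ltW.
by rewrite -natrX ler_nat ltnW// ltn_expl.
Qed.

(** [A] collects the monomials of the first [M] translated polynomials. Restricting to a larger
    finite set [B] leaves these unchanged, and never exceeds the norm of the later ones, so the
    error is the tail from [M] on of a series bounded by $2D/2^k$. *)
Lemma taylor_sum p a x (e : R) : entire p -> (forall i, `|x i ord0| <= 1) ->
  0 < e -> exists A : {fset {ffun 'I_l -> nat}}, forall B, (A `<=` B)%fset ->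
    `|\sum_(m <- B) taylor_coef p a m * monomial m x - polysum p (a + x)| < e.
Proof.
move=> ep x1 e0; have [D qD] := entire_shift a ep ler01.
have D0 : 0 <= D.
  have := qD 0%N; rewrite expr0 divr1; apply: le_trans.
  by apply: wnorm_ge0 => i; exact: ler01.
have [|M Me] := @ltr_div_expn2 (2 * (D + D)) e _ e0.
  by rewrite mulr_ge0// addr_ge0.
pose q := shift_seq a p.
pose A := [fset m in [seq ffun_of_mnm m |
  m <- flatten [seq mpoly.msupp (q k) | k <- iota 0 M]]]%fset.
exists A => B AB; pose s : seq (mpoly.multinom l) := map mnm_of_ffun B.
have us : uniq s by rewrite map_inj_uniq ?fset_uniq//; exact: can_inj mnm_of_ffunK.
have qs k : (k < M)%N -> {subset mpoly.msupp (q k) <= s}.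
  move=> kM m mq; apply/mapP; exists (ffun_of_mnm m); last by rewrite ffun_of_mnmK.
  apply: (fsubsetP AB); rewrite !inE/=; apply: map_f; apply/flattenP.
  exists (mpoly.msupp (q k)) => //; apply: map_f.
  by rewrite mem_iota.
(* A single coefficient is a one-term partial sum at the point with all coordinates 1. *)
have coefD m : geo_bounded D (fun k => (q k)@_m).
  move=> k; apply: le_trans (qD k).
  have := @ler_norm_partial (q k) (const_mx 1) [:: m] isT.
  rewrite big_seq1 /pw /wmon big1 ?mulr1 => [|i _]; last by rewrite mxE expr1n.
  by apply=> i; rewrite mxE normr1.
have pwE m : monomial m x = pw x (mnm_of_ffun m).
  by apply: eq_bigr => i _; rewrite mnm_of_ffunE.
have evD : geo_bounded D (fun k => peval (q k) x).
  move=> k; apply: le_trans (qD k); apply: ler_norm_meval => [i|i].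
    exact: ler01.
  exact: x1.
have sD : geo_bounded D (fun k => \sum_(m <- s) (q k)@_m * pw x m).
  by move=> k; apply: le_trans (qD k); exact: ler_norm_partial.
have -> : \sum_(m <- B) taylor_coef p a m * monomial m x =
    limn (series (fun k => \sum_(m <- s) (q k)@_m * pw x m)).
  pose u m k := pw x (mnm_of_ffun m) * (q k)@_(mnm_of_ffun m).
  have := @lim_geo_bounded_sum R _ (enum_fset B) u
    (fun m => `|pw x (mnm_of_ffun m)| * D) (fun m => geo_boundedZ _ (coefD _)).
  under eq_fun do under eq_bigr do rewrite /u mulrC.
  rewrite /s; under [in X in _ = X -> _]eq_bigr do
    rewrite /u (lim_geo_boundedZ _ (coefD _)) mulrC -pwE.
  by move=> <-; congr (limn (series _)); apply/funext => k; rewrite big_map.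
have -> : polysum p (a + x) = limn (series (fun k => peval (q k) x)).
  by congr (limn (series _)); apply/funext => k; rewrite peval_shift.
rewrite -(lim_geo_boundedB sD evD).
have := geo_bounded_tail M (geo_boundedB sD evD).
rewrite [X in _ - X](_ : _ = 0) ?subr0 => [|]; last first.
  rewrite /series/= big_nat big1// => k /andP[_ kM].
  by rewrite -peval_sup ?subrr//; exact: qs.
by move/le_lt_trans; apply.
Qed.

Lemma has_sum_complex (I : choiceType) (c1 c2 w : I -> R) (s1 s2 : R) :
  (forall e : R, 0 < e -> exists A : {fset I}, forall B, (A `<=` B)%fset ->
    `|\sum_(i <- B) c1 i * w i - s1| < e) ->
  (forall e : R, 0 < e -> exists A : {fset I}, forall B, (A `<=` B)%fset ->
    `|\sum_(i <- B) c2 i * w i - s2| < e) ->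
  has_sum (fun i => (c1 i +i* c2 i)%C * ((w i)%:C)%C) (s1 +i* s2)%C.
Proof.
move=> h1 h2 e e0; have e20 : 0 < e / 2 by rewrite divr_gt0.
have [A1 A1P] := h1 _ e20; have [A2 A2P] := h2 _ e20.
exists (A1 `|` A2)%fset => B; rewrite fsubUset => /andP[/A1P B1 /A2P B2].
have -> : \sum_(i <- B) (c1 i +i* c2 i)%C * ((w i)%:C)%C =
    ((\sum_(i <- B) c1 i * w i) +i* (\sum_(i <- B) c2 i * w i))%C.
  elim/big_rec3: _ => // i y1 y2 y3 _ ->.
  by apply/eqP; rewrite eq_complex/= !mulr0 subr0 add0r !eqxx.
set S1 := \sum_(i <- B) _; set S2 := \sum_(i <- B) _.
have -> : (S1 +i* S2)%C - (s1 +i* s2)%C = ((S1 - s1) +i* (S2 - s2))%C by [].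
rewrite normc_def /= ltcR -[e]gtr0_norm// -sqrtr_sqr ltr_sqrt ?exprn_gt0//.
rewrite -real_normK ?num_real// -(@real_normK _ (S2 - s2)) ?num_real//.
rewrite -/S1 in B1; rewrite -/S2 in B2.
move: (normr_ge0 (S1 - s1)) (normr_ge0 (S2 - s2)) B1 B2.
move: `|S1 - s1| `|S2 - s2| => a b a0 b0 ae be; nra.
Qed.

Lemma entire_real_analytic (p1 p2 : nat -> mpoly.mpoly l R) :
  entire p1 -> entire p2 ->
  real_analytic (fun x => (polysum p1 x +i* polysum p2 x)%C).
Proof.
move=> ep1 ep2 a.
exists (fun m => (taylor_coef p1 a m +i* taylor_coef p2 a m)%C).
apply: filterS (near_coord a ltr01) => x xa.
rewrite -{2 3}[x](subrKC a).
by apply: has_sum_complex => e e0; exact: taylor_sum.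
Qed.

End PowerSeries.

(** * Integration *)

Section IntegralSeries.
Context d (T : measurableType d) (R : realType).
Variables (mu : {measure set T -> \bar R}) (D : set T) (mD : measurable D).

Lemma dominated_integrable_EFin (f g : T -> R) : measurable_fun D f ->
  mu.-integrable D (EFin \o g) -> (forall x, D x -> `|f x| <= g x) ->
  mu.-integrable D (EFin \o f).
Proof.
move=> mf ig fg; apply: (le_integrable mD) ig; first exact/measurable_EFinP.
by move=> x Dx /=; rewrite lee_fin (le_trans (fg x Dx))// ler_norm.
Qed.

Lemma Rintegral_sum (I : Type) (s : seq I) (f : I -> T -> R) :
  (forall i, mu.-integrable D (EFin \o f i)) ->
  \int[mu]_(x in D) (\sum_(i <- s) f i x) =
  \sum_(i <- s) \int[mu]_(x in D) f i x.
Proof.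
move=> fi; elim: s => [|i s IH].
  rewrite big_nil; under eq_Rintegral do rewrite big_nil.
  by rewrite /Rintegral integral0.
rewrite big_cons -IH -RintegralD//.
  by apply: eq_Rintegral => x _; rewrite big_cons.
rewrite (_ : _ \o _ = (fun x => \sum_(j <- s) (f j x)%:E)%E).
  by apply: integrable_sum => // j _; exact: fi.
by apply/funext => x /=; rewrite sumEFin.
Qed.

Variables (u : nat -> T -> R) (F : T -> R).
Hypothesis mu_ : forall m, measurable_fun D (u m).
Hypothesis iF : mu.-integrable D (EFin \o F).
Hypothesis uF : forall m x, D x -> `|u m x| <= F x / 2 ^+ m.

Let ui m : mu.-integrable D (EFin \o u m).
Proof.
apply: dominated_integrable_EFin iF _ => // x Dx.
have F0 : 0 <= F x by have := uF 0 Dx; rewrite expr0 divr1; exact: le_trans.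
rewrite (le_trans (uF m Dx))// ler_pdivrMr ?exprn_gt0// ler_peMr//.
by rewrite exprn_ege1// ler1n.
Qed.

Lemma integral_series :
  mu.-integrable D (EFin \o (fun x => limn (series (u ^~ x)))) /\
  \int[mu]_(x in D) limn (series (u ^~ x)) =
  limn (series (fun m => \int[mu]_(x in D) u m x)).
Proof.
pose f_ n x := series (u ^~ x) n.
have geo x : D x -> geo_bounded (F x) (u ^~ x) by move=> Dx m; exact: uF.
have mf_ n : measurable_fun D (f_ n) by apply: measurable_sum.
have cf x : D x -> f_ ^~ x @ \oo --> limn (series (u ^~ x)).
  by move=> /geo/geo_bounded_cvg.
have mf : measurable_fun D (fun x => limn (series (u ^~ x))).
  exact: measurable_fun_cvg cf.
(* The constant 4 comes from bounding a partial sum by the limit plus the tail, each at most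
   $2F$. *)
have i2F : mu.-integrable D (EFin \o (fun x => 4 * F x)).
  rewrite (_ : _ \o _ = (fun x => 4%:E * (EFin \o F) x)%E); last first.
    by apply/funext => x /=; rewrite EFinM.
  exact: integrableZl.
have fF n x : D x -> `|f_ n x| <= 4 * F x.
  move=> Dx; have gx := geo _ Dx.
  have F0 : 0 <= F x := geo_bounded_ge0 gx.
  have := geo_bounded_tail n gx; have := geo_bounded_lim gx.
  rewrite -/(f_ n x); set L := limn _ => L1 L2.
  rewrite -[f_ n x](subKr L) (le_trans (ler_normB _ _))//.
  have -> : 4 * F x = 2 * F x + 2 * F x by rewrite -mulrDl -natrD.
  rewrite lerD// (le_trans L2)// ler_pdivrMr ?exprn_gt0// ler_peMr ?mulr_ge0//.
  by rewrite exprn_ege1// ler1n.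
have [|||||] := @dominated_convergence _ _ _ mu D mD (fun n => EFin \o f_ n)
  (EFin \o (fun x => limn (series (u ^~ x)))) (EFin \o (fun x => 4 * F x)).
- by move=> n; exact/measurable_EFinP.
- exact/measurable_EFinP.
- by apply: aeW => x Dx; apply: cvg_EFin; [exact: nearW|exact: cf].
- exact: i2F.
- by apply: aeW => x n Dx; rewrite lee_fin; exact: fF.
move=> ilim _ cint; split=> //.
apply/esym/cvg_lim => //.
have -> : series (fun m => \int[mu]_(x in D) u m x) =
    (fun n => fine (\int[mu]_(x in D) (f_ n x)%:E)%E).
  by apply/funext => n; rewrite /series/= -Rintegral_sum.
apply: fine_cvg; rewrite /Rintegral fineK; first exact: cint.
exact: integrable_fin_num.
Qed.

End IntegralSeries.

(** * Borel measurability of matrix operations *)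

Section MatrixMeasurability.
Variable R : realType.

Lemma continuous_measurable_mx m n (f : 'M[R]_(m, n) -> R) :
  continuous f -> measurable_fun setT f.
Proof.
move=> cf; apply: (measurability _ (RGenOpens.measurableE R)) => _ [_ [a [b ->]] <-].
rewrite setTI; apply: sub_sigma_algebra; exact: open_comp.
Qed.

Lemma compact_measurable_mx m n (K : set 'M[R]_(m, n)) :
  compact K -> measurable K.
Proof.
move=> /(compact_closed (@norm_hausdorff _ _)) cK.
rewrite -[K]setCK; apply: measurableC; apply: sub_sigma_algebra.
exact: closed_openC.
Qed.

Lemma measurable_mulmxr m n p (A : 'M[R]_(m, n)) :
  measurable_fun setT (fun B : 'M[R]_(n, p) => A *m B).
Proof.
apply: measurable_fun_mx => i j; under eq_fun do rewrite mxE.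
apply: measurable_sum => k; apply: measurable_funM => //.
exact: measurable_coord_mx.
Qed.

Lemma measurable_oppmx m n : measurable_fun setT (fun A : 'M[R]_(m, n) => - A).
Proof.
apply: measurable_fun_mx => i j; under eq_fun do rewrite mxE.
apply: (measurableT_comp (@oppr_measurable R setT)).
exact: measurable_coord_mx.
Qed.

End MatrixMeasurability.

(** * Invariance of the Lebesgue measure under reflection *)

Section LebesgueOpp.
Variable R : realType.

Let opp_R : measurableTypeR R -> measurableTypeR R := fun x => - x.

Let measurable_opp_R : measurable_fun setT opp_R.
Proof. exact: oppr_measurable. Qed.

Let opp_mu := measure_function_pushforward__canonical__measure_function_Measure
  (@lebesgue_measure R) measurable_opp_R.

(** By uniqueness it is enough to compare lengths of half-open intervals; reflection moves the
    closed end to the other side without changing the length. *)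
Lemma lebesgue_measure_opp (A : set R) : measurable A ->
  lebesgue_measure (-%R @^-1` A) = lebesgue_measure A.
Proof.
move=> mA; apply/esym. apply: (@lebesgue_measure_unique R opp_mu) => // X.
move=> /ocitvP[->|[[a b] /= ab ->]].
  by rewrite /= /pushforward preimage_set0 !measure0.
rewrite /= /pushforward (_ : -%R @^-1` _ = [set` `[- b, - a[]).
  by rewrite !lebesgue_measure_itv/= !lte_fin ltrN2 -!EFinB opprK addrC.
by apply/seteqP; split => x /=; rewrite !in_itv/= lerNl ltrNr andbC.
Qed.

(** Induction along the iterated product: the reflected product measure agrees with the product
    measure on rectangles, hence everywhere. *)
Lemma lebesgue_cV_opp n (A : set 'cV[R]_n) : measurable A ->
  lebesgue_cV R n (-%R @^-1` A) = lebesgue_cV R n A.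
Proof.
elim: n A => [|n IH] A mA.
  congr (_ _); apply/funext => x.
  by rewrite /preimage/= [x]flatmx0 oppr0.
pose mu := lebesgue_cV R n.
pose phi (p : (measurableTypeR R * 'cV[R]_n)%type) :
  (measurableTypeR R * 'cV[R]_n)%type := (opp_R p.1, - p.2).
have mphi : measurable_fun setT phi.
  apply: measurable_fun_pair.
    exact: (measurableT_comp measurable_opp_R measurable_fst).
  exact: (measurableT_comp (@measurable_oppmx R n 1) measurable_snd).
pose prod_mu : {measure set (measurableTypeR R * 'cV[R]_n)%type -> \bar R} :=
  (lebesgue_measure \x mu)%E.
pose m' := measure_function_pushforward__canonical__measure_function_Measure
  prod_mu mphi.
have consN p : cons_cV (phi p) = - cons_cV p.
  apply/matrixP => i j; rewrite [RHS]mxE /cons_cV !mxE.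
  by case: (fintype.split _) => k; rewrite !mxE.
have mB : measurable (@cons_cV R n @^-1` A).
  by rewrite -[X in measurable X]setTI; exact: measurable_cons_cV.
rewrite /= /lebesgue_cVS /pushforward.
rewrite [RHS](@product_measure_unique _ _ _ _ _ lebesgue_measure mu m')//.
  rewrite /m' /= /pushforward; congr (_ _); apply/funext => p.
  by rewrite /preimage/= consN.
move=> B C mB' mC.
rewrite /m' /= /pushforward (_ : _ @^-1` _ = (-%R @^-1` B) `*` (-%R @^-1` C))//.
have mBo : measurable (-%R @^-1` B).
  by rewrite -[X in measurable X]setTI; exact: oppr_measurable.
have mCo : measurable (-%R @^-1` C).
  by rewrite -[X in measurable X]setTI; exact: measurable_oppmx.
rewrite product_measure1E//; congr (_ * _)%E; last exact: IH.
exact: lebesgue_measure_opp.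
Qed.

Lemma Rintegral_opp n (f : 'cV[R]_n -> R) : measurable_fun setT f ->
  (lebesgue_cV R n).-integrable setT (EFin \o f) ->
  \int[lebesgue_cV R n]_x f (- x) = \int[lebesgue_cV R n]_x f x.
Proof.
move=> mf fi; rewrite /Rintegral; congr fine.
pose nu := measure_function_pushforward__canonical__measure_function_Measure
  (lebesgue_cV R n) (@measurable_oppmx R n 1).
have nuE A : measurable A -> nu A = lebesgue_cV R n A.
  by move=> mA; exact: lebesgue_cV_opp.
have ifo : (lebesgue_cV R n).-integrable setT ((EFin \o f) \o -%R).
  apply/integrableP; split.
    by apply: measurableT_comp (@measurable_oppmx R n 1); exact/measurable_EFinP.
  have [_] := integrableP _ _ _ fi; apply: le_lt_trans.
  rewrite -[leRHS](@eq_measure_integral _ _ _ _ _ nu); last first.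
    by move=> A mA _; rewrite nuE.
  rewrite ge0_integral_pushforward//; first exact: measurable_oppmx.
  by apply/measurableT_comp => //; exact/measurable_EFinP.
have := @integral_pushforward _ _ _ _ R _ (@measurable_oppmx R n 1)
  (lebesgue_cV R n) setT (EFin \o f).
rewrite preimage_setT => /(_ _ ifo measurableT) <-; last exact/measurable_EFinP.
apply: (@eq_measure_integral _ _ _ setT (lebesgue_cV R n) nu) => A mA _.
exact: nuE.
Qed.

End LebesgueOpp.

(** * Invariance of Haar integrals under translation and inversion *)

Section Haar.
Variables (R : realType) (n : nat) (K : set 'M[R]_n).
Variable dk : probability 'M[R]_n R.
Hypotheses (Kgroup : orthogonal_subgroup K) (Kcompact : compact K).
Hypothesis Khaar : normalized_haar K dk.

Lemma orthogonal_subgroup_tr k : K k -> K k^T.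
Proof.
have [_ _ KV KO] := Kgroup => Kk; suff -> : k^T = invmx k by exact: KV.
have ku : k \in unitmx by case: (mulmx1_unit (KO _ Kk)).
by rewrite -[RHS]mul1mx -(KO _ Kk) mulmxK.
Qed.

Lemma orthogonal_subgroup_mulmxtr k : K k -> k *m k^T = 1%:M.
Proof. by have [_ _ _ KO] := Kgroup => Kk; apply/mulmx1C/KO. Qed.

Lemma orthogonal_subgroup_mulmxl k k' : K k -> K (k *m k') <-> K k'.
Proof.
have [_ KM KV KO] := Kgroup => Kk; split=> [Kkk'|]; last exact: KM.
have -> : k' = k^T *m (k *m k') by rewrite mulmxA KO// mul1mx.
by apply: KM => //; exact: orthogonal_subgroup_tr.
Qed.

(** The columns of an orthogonal matrix are unit vectors. *)
Lemma orthogonal_subgroup_entry k i j : K k -> `|k i j| <= 1.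
Proof.
have [_ _ _ KO] := Kgroup => /KO /matrixP /(_ j j); rewrite !mxE eqxx => k1.
rewrite -(@ler_pXn2r _ 2)// ?nnegrE// expr1n real_normK ?num_real// -[leRHS]k1.
rewrite (bigD1 i)//= mxE -expr2 lerDl sumr_ge0// => i' _.
by rewrite mxE -expr2 sqr_ge0.
Qed.

Let mK : measurable K. Proof. exact: compact_measurable_mx. Qed.

Let dkK : dk K = 1%E. Proof. by have [] := Khaar. Qed.

Lemma haar_bounded_integrable (f : 'M[R]_n -> R) (B : R) :
  measurable_fun K f -> (forall k, K k -> `|f k| <= B) ->
  dk.-integrable K (EFin \o f).
Proof.
move=> mf fB; apply: (@dominated_integrable_EFin _ _ _ _ _ mK _ (cst B)) => //.
apply: measurable_bounded_integrable => //.
  by rewrite (le_lt_trans (probability_le1 _ _))// ltry.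
by exists `|B|; split; [exact: num_real|move=> M BM x _; exact: ltW].
Qed.

Lemma haar_left_invariant (f : 'M[R]_n -> R) (B : R) k0 : K k0 ->
  measurable_fun setT f -> (forall k, K k -> `|f k| <= B) ->
  \int[dk]_(k in K) f (k0 *m k) = \int[dk]_(k in K) f k.
Proof.
move=> Kk0 mf fB; rewrite /Rintegral; congr fine.
pose nu := measure_function_pushforward__canonical__measure_function_Measure
  dk (@measurable_mulmxr R n n n k0).
have preK : (fun k => k0 *m k) @^-1` K = K.
  by apply/seteqP; split=> k /=; rewrite orthogonal_subgroup_mulmxl.
have fi : dk.-integrable K ((EFin \o f) \o (fun k => k0 *m k)).
  apply: (@haar_bounded_integrable (fun k => f (k0 *m k)) B) => [|k Kk].
    apply: measurable_funTS; apply: measurableT_comp mf _.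
    exact: measurable_mulmxr.
  by apply: fB; rewrite orthogonal_subgroup_mulmxl.
have := @integral_pushforward _ _ _ _ R _ (@measurable_mulmxr R n n n k0)
  dk K (EFin \o f).
rewrite preK => /(_ _ fi mK) <-; last exact/measurable_EFinP.
apply: (@eq_measure_integral _ _ _ K dk nu) => A mA AK.
rewrite /nu /= /pushforward; set A' := _ @^-1` A.
have A'K : A' `<=` K by move=> k /AK /=; rewrite orthogonal_subgroup_mulmxl.
have mA' : measurable A'.
  by rewrite -[X in measurable X]setTI; exact: measurable_mulmxr.
(* The Haar property speaks of direct images: it is applied to the preimage [A'], whose translate by
   [k0] is [A]. *)
rewrite -(Khaar.2 k0)//; congr (_ _); apply/seteqP; split=> [_ [k A'k <-]//|k Ak].
have E : k0 *m (k0^T *m k) = k.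
  by rewrite mulmxA orthogonal_subgroup_mulmxtr// mul1mx.
by exists (k0^T *m k); rewrite /A' /= ?E.
Qed.

Lemma measurable_trmulmx m p q : measurable_fun setT
  (fun kk : 'M[R]_(m, p) * 'M[R]_(m, q) => kk.1^T *m kk.2).
Proof.
apply: measurable_fun_mx => i j; under eq_fun do rewrite mxE.
apply: measurable_sum => k; apply: measurable_funM => //.
  under eq_fun do rewrite mxE.
  exact: measurableT_comp (measurable_coord_mx _ _) measurable_fst.
exact: measurableT_comp (measurable_coord_mx _ _) measurable_snd.
Qed.

(* Both sides are the integral of [f (k^T *m k')] over [K x K], integrated in the
   two possible orders. *)
Lemma haar_inv_invariant (f : 'M[R]_n -> R) (B : R) :
  measurable_fun setT f -> (forall k, K k -> `|f k| <= B) ->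
  \int[dk]_(k in K) f k^T = \int[dk]_(k in K) f k.
Proof.
move=> mf fB.
have mT : measurable_fun setT (fun k : 'M[R]_n => f k^T).
  apply: (@measurableT_comp _ _ _ _ _ _ f setT (fun k : 'M[R]_n => k^T) mf).
  apply: measurable_fun_mx => i j.
  by under eq_fun do rewrite mxE; exact: measurable_coord_mx.
(* Extension by zero outside [K] x [K], so that Fubini's theorem applies on the whole product. *)
pose F := (fun kk : 'M[R]_n * 'M[R]_n => f (kk.1^T *m kk.2)) \_ (K `*` K).
have mKK : measurable (K `*` K) by exact: measurableX.
have mF : measurable_fun setT F.
  apply/(measurable_restrictT _ mKK); apply: measurable_funTS.
  exact: (@measurableT_comp _ _ _ _ _ _ f setT
    (fun kk : 'M[R]_n * 'M[R]_n => kk.1^T *m kk.2) mf (@measurable_trmulmx n n n)).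
have FB kk : `|F kk| <= `|B|.
  rewrite /F patchE; case: ifPn => [|_]; last by rewrite normr0.
  rewrite inE => -[/= K1 K2]; apply: le_trans (ler_norm _); apply: fB.
  by rewrite orthogonal_subgroup_mulmxl//; exact: orthogonal_subgroup_tr.
have iF : (dk \x dk)%E.-integrable setT (EFin \o F).
  apply: measurable_bounded_integrable => //.
    apply: le_lt_trans (ltry 1); rewrite le_eqVlt; apply/orP; left; apply/eqP.
    exact: (probability_setT (dk \x dk)%E).
  exists `|B|; split; [exact: num_real|move=> M BM kk _].
  exact: le_trans (ltW BM).
have cstK (c : R) : \int[dk]_(k in K) c = c by rewrite Rintegral_cst//= dkK mulr1.
have intK (g : 'M[R]_n -> R) : (forall k, K k -> `|g k| <= B) ->
    measurable_fun setT g ->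
    (\int[dk]_k ((g \_ K) k)%:E)%E = (\int[dk]_(k in K) g k)%:E.
  move=> gB mg; rewrite /Rintegral fineK.
    by rewrite integral_mkcond/=; under [RHS]eq_integral do rewrite restrict_EFin.
  apply: integrable_fin_num => //.
  by apply: haar_bounded_integrable gB; exact: measurable_funTS.
have fK k k' : K k -> K k' -> `|f (k^T *m k')| <= B.
  move=> /orthogonal_subgroup_tr Kk Kk'; apply: fB.
  by rewrite orthogonal_subgroup_mulmxl.
have mfl k : measurable_fun setT (fun k' : 'M[R]_n => f (k *m k')).
  apply: (@measurableT_comp _ _ _ _ _ _ f setT (fun k' : 'M[R]_n => k *m k') mf).
  exact: measurable_mulmxr.
have B0 : 0 <= B by have [K1 _ _ _] := Kgroup; exact: le_trans (fB _ K1).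
have E1 k : (\int[dk]_k' (F (k, k'))%:E)%E =
    (((fun=> \int[dk]_(k in K) f k) \_ K) k)%:E.
  rewrite patchE; case: ifPn => [|kNK].
    rewrite inE => Kk; have KkT := orthogonal_subgroup_tr Kk.
    rewrite -(haar_left_invariant KkT mf fB) -intK//; last by move=> k'; exact: fK.
    apply: eq_integral => k' _; rewrite /F !patchE/=; congr (_%:E).
    by rewrite in_setX/= (mem_set Kk).
  rewrite -[RHS](integral0 dk setT); apply: eq_integral => k' _.
  by rewrite /F patchE in_setX/= (negbTE kNK).
(* Since [k^T *m k'] is the transpose of [k'^T *m k], left invariance is applied here to [f]
   composed with transposition. *)
have E2 k' : (\int[dk]_k (F (k, k'))%:E)%E =
    (((fun=> \int[dk]_(k in K) f k^T) \_ K) k')%:E.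
  rewrite patchE; case: ifPn => [|kNK].
    rewrite inE => Kk'; have KkT := orthogonal_subgroup_tr Kk'.
    rewrite -(haar_left_invariant (f := fun k => f k^T) KkT mT (B := B)); last first.
      by move=> k Kk; apply/fB/orthogonal_subgroup_tr.
    rewrite -intK.
    - apply: eq_integral => k _; rewrite /F !patchE/=; congr (_%:E).
      by rewrite in_setX/= (mem_set Kk') andbT trmx_mul trmxK.
    - by move=> k Kk; rewrite trmx_mul trmxK; exact: fK.
    - exact: (@measurableT_comp _ _ _ _ _ _ (fun k => f k^T) setT
        (fun k : 'M[R]_n => k'^T *m k) mT (@measurable_mulmxr R n n n k'^T)).
  rewrite -[RHS](integral0 dk setT); apply: eq_integral => k _.
  by rewrite /F patchE in_setX/= (negbTE kNK) andbF.
have := Fubini iF; under eq_integral do rewrite E1.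
under [in X in _ = X -> _]eq_integral do rewrite E2.
have cB (g : 'M[R]_n -> R) (mg : measurable_fun setT g)
    (gB : forall k, K k -> `|g k| <= B) :
    (\int[dk]_k (((fun=> (\int[dk]_(k in K) g k)%R) \_ K) k)%:E)%E =
    (\int[dk]_(k in K) g k)%:E.
  rewrite intK ?cstK// => k _.
  rewrite -[leRHS]cstK (le_trans (le_normr_Rintegral _ _))//.
    by apply: haar_bounded_integrable gB; exact: measurable_funTS.
  apply: le_Rintegral => //.
  - apply: (@haar_bounded_integrable _ B).
      by apply: measurableT_comp => //; exact: measurable_funTS.
    by move=> k' /gB; rewrite normr_id.
  - by apply: (@haar_bounded_integrable _ B) => // k' _; rewrite ger0_norm.
rewrite cB// cB//; first by case.
by move=> k Kk; apply/fB/orthogonal_subgroup_tr.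
Qed.

End Haar.

(** * Expansion of the spherical functions *)

Section TrigCoefficients.
Variable R : realType.

(** [cos_sign] and [sin_sign] are the real and imaginary parts of $i^m$. They put cosine and sine in
    the same form, a signed exponential series indexed by all m. *)
Definition cos_sign m : R := (~~ odd m)%:R * (-1) ^+ m./2.
Definition sin_sign m : R := (odd m)%:R * (-1) ^+ m.-1./2.

Lemma cos_sign_series (x : R) :
  cos x = limn (series (fun m => cos_sign m * (x ^+ m / m`!%:R))).
Proof.
rewrite cosE; congr (limn (series _)); apply/funext => m.
by rewrite /cos_sign -!mulrA; congr (_ * (_ * _)); rewrite mulrC.
Qed.

Lemma sin_sign_series (x : R) :
  sin x = limn (series (fun m => sin_sign m * (x ^+ m / m`!%:R))).
Proof.
rewrite sinE; congr (limn _); apply/funext => k; rewrite /pseries/=.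
apply: eq_bigr => m _.
by rewrite /sin_sign -!mulrA; congr (_ * (_ * _)); rewrite mulrC.
Qed.

Lemma cos_sign_le1 m : `|cos_sign m| <= 1.
Proof. by rewrite normrM normrX normrN1 expr1n mulr1 normr_nat; case: odd. Qed.

Lemma sin_sign_le1 m : `|sin_sign m| <= 1.
Proof. by rewrite normrM normrX normrN1 expr1n mulr1 normr_nat; case: odd. Qed.

Lemma ler_expR_coeff (y : R) m : 0 <= y -> y ^+ m / m`!%:R <= expR y.
Proof.
case: m => [|m] y0.
  by rewrite expr0 fact0 divr1 (le_trans _ (expR_ge1Dx y))// lerDl.
by rewrite (le_trans _ (expR_ge1Dxn m y0))// lerDr.
Qed.

(** The exponential series at $2y$ instead of $y$ yields the geometric decay that all the series
    below rely on. *)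
Lemma ler_expR_geo (y : R) m : 0 <= y ->
  y ^+ m / m`!%:R <= expR (2 * y) / 2 ^+ m.
Proof.
move=> y0; rewrite ler_pdivlMr ?exprn_gt0// mulrAC -exprMn [y * 2]mulrC.
by apply: ler_expR_coeff; rewrite mulr_ge0.
Qed.

End TrigCoefficients.

Section Words.
Import -(notations) mpoly.
Variables (R : comNzRingType) (n : nat).

(* Powers of a scalar product are expanded over words, that is over
   noncommutative monomials, so that no multinomial coefficient appears. *)
Definition word_mnm m (w : {ffun 'I_m -> 'I_n}) : multinom n :=
  \big[@mnm_add n/@mnm0 n]_(s < m) mnm1 (w s).

Lemma mdeg_word m (w : {ffun 'I_m -> 'I_n}) : mdeg (word_mnm w) = m.
Proof.
rewrite mdeg_sum (eq_bigr (fun=> 1%N)) => [|s _]; last by rewrite mdeg1.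
by rewrite sum1_card card_ord.
Qed.

Lemma meval_word (v : 'I_n -> R) m (w : {ffun 'I_m -> 'I_n}) :
  meval v (mpolyX R (word_mnm w)) = \prod_s v (w s).
Proof.
rewrite /word_mnm -mprodXE rmorph_prod; apply: eq_bigr => s _.
exact: mevalXU.
Qed.

Lemma exprn_sum_words (x y : 'I_n -> R) m : (\sum_i x i * y i) ^+ m =
  \sum_(w : {ffun 'I_m -> 'I_n}) (\prod_s x (w s)) * \prod_s y (w s).
Proof.
rewrite -[m in LHS]card_ord -prodr_const bigA_distr_bigA.
by apply: eq_bigr => w _; rewrite big_split.
Qed.

End Words.

(** * Measurability of integrals depending on a parameter *)

Section ParametricMeasurability.
Context d1 d2 (T1 : measurableType d1) (T2 : measurableType d2) (R : realType).
Variable mu : {sigma_finite_measure set T2 -> \bar R}.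

(** Tonelli's theorem gives the measurability of the integrals of the positive and negative parts,
    extended by zero outside [K]; the integral is [fine] of their difference. *)
Lemma measurable_Rintegral_param (K : set T2) (f : T1 * T2 -> R) :
  measurable K -> measurable_fun setT f ->
  measurable_fun setT (fun x => \int[mu]_(y in K) f (x, y)).
Proof.
move=> mK mf; pose F := (f \_ (setT `*` K)).
have mTK : measurable ([set: T1] `*` K) by exact: measurableX.
have mF : measurable_fun setT (EFin \o F).
  by apply/measurable_EFinP/(measurable_restrictT _ mTK)/measurable_funTS.
have -> : (fun x => \int[mu]_(y in K) f (x, y)) = fine \o
    (fun x => fubini_F mu ((EFin \o F)^\+)%E x - fubini_F mu ((EFin \o F)^\-)%E x)%E.
  apply/funext => x; rewrite Rintegral_mkcond /Rintegral /=; congr fine.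
  rewrite integralE; congr (_ - _)%E; apply: eq_integral => y _.
    by rewrite !funeposE /= /F !patchE in_setX/= in_setT.
  by rewrite !funenegE /= /F !patchE in_setX/= in_setT.
apply: measurableT_comp; first exact: fine_measurable.
apply: emeasurable_funB.
  by apply: measurable_fun_fubini_tonelli_F => //; exact: measurable_funepos.
by apply: measurable_fun_fubini_tonelli_F => //; exact: measurable_funeneg.
Qed.

End ParametricMeasurability.

(** * Moments over K and the homogeneous terms of the spherical functions *)

Section SphericalExpansion.
Import -(notations) mpoly.
Variables (R : realType) (n l : nat) (K : set 'M[R]_n).
Variable dk : probability 'M[R]_n R.
Hypotheses (Kgroup : orthogonal_subgroup K) (Kcompact : compact K).
Hypothesis Khaar : normalized_haar K dk.
Implicit Types (xi x : 'cV[R]_n) (m : nat).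

Let mK : measurable K. Proof. exact: compact_measurable_mx. Qed.

Definition norm1 xi : R := \sum_j `|xi j ord0|.

Lemma norm1_ge0 xi : 0 <= norm1 xi.
Proof. exact: sumr_ge0. Qed.

Lemma ler_entry_norm1 k xi i : K k -> `|(k *m xi) i ord0| <= norm1 xi.
Proof.
move=> Kk; rewrite mxE (le_trans (ler_norm_sum _ _ _))//.
apply: ler_sum => j _; rewrite normrM ler_piMl//.
exact: orthogonal_subgroup_entry Kk.
Qed.

Lemma ler_dotp_norm1 k x xi : K k ->
  `|dotp x (k *m xi)| <= norm1 x * norm1 xi.
Proof.
move=> Kk; rewrite /dotp (le_trans (ler_norm_sum _ _ _))// mulr_suml.
by apply: ler_sum => i _; rewrite normrM ler_wpM2l// ler_entry_norm1.
Qed.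

Lemma dotp_tr k x xi : dotp x (k *m xi) = dotp xi (k^T *m x).
Proof.
have dotpE (y z : 'cV[R]_n) : dotp y z = (y^T *m z) ord0 ord0.
  by rewrite mxE; apply: eq_bigr => i _; rewrite mxE.
rewrite !dotpE.
have -> : xi^T *m (k^T *m x) = (x^T *m (k *m xi))^T.
  by rewrite !trmx_mul trmxK mulmxA.
by rewrite [RHS]mxE.
Qed.

Lemma measurable_dotp x xi :
  measurable_fun setT (fun k : 'M[R]_n => dotp x (k *m xi)).
Proof.
apply: measurable_sum => i; apply: measurable_funM => //.
under eq_fun do rewrite mxE; apply: measurable_sum => j.
by apply: measurable_funM => //; exact: measurable_coord_mx.
Qed.

Definition word_prod m (w : {ffun 'I_m -> 'I_n}) xi k : R :=
  \prod_s (k *m xi) (w s) ord0.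

Lemma ler_word_prod m (w : {ffun 'I_m -> 'I_n}) xi k : K k ->
  `|word_prod w xi k| <= norm1 xi ^+ m.
Proof.
move=> Kk; rewrite /word_prod normr_prod -[m in leRHS]card_ord -prodr_const.
by apply: ler_prod => s _; rewrite normr_ge0/= ler_entry_norm1.
Qed.

Lemma measurable_word_prod m (w : {ffun 'I_m -> 'I_n}) :
  measurable_fun setT (fun p : 'cV[R]_n * 'M[R]_n => word_prod w p.1 p.2).
Proof.
apply: measurable_prod => s _; under eq_fun do rewrite mxE.
apply: measurable_sum => j; apply: measurable_funM.
  exact: measurableT_comp (measurable_coord_mx _ _) measurable_snd.
exact: measurableT_comp (measurable_coord_mx _ _) measurable_fst.
Qed.

Definition word_moment m (w : {ffun 'I_m -> 'I_n}) xi : R :=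
  \int[dk]_(k in K) word_prod w xi k.

Lemma word_prod_integrable m (w : {ffun 'I_m -> 'I_n}) xi :
  dk.-integrable K (EFin \o word_prod w xi).
Proof.
apply: (haar_bounded_integrable dk Kcompact (B := norm1 xi ^+ m)); last first.
  by move=> k; exact: ler_word_prod.
apply: measurable_funTS; apply: measurable_prod => s _.
under eq_fun do rewrite mxE; apply: measurable_sum => j.
by apply: measurable_funM => //; exact: measurable_coord_mx.
Qed.

Lemma ler_word_moment m (w : {ffun 'I_m -> 'I_n}) xi :
  `|word_moment w xi| <= norm1 xi ^+ m.
Proof.
have wi := word_prod_integrable w xi.
rewrite (le_trans (le_normr_Rintegral _ _))//.
have [dkK _] := Khaar.
rewrite -[leRHS]mulr1 -[X in _ <= _ * X]/(fine 1%E) -dkK -Rintegral_cst//.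
apply: le_Rintegral => //.
- by apply: (haar_bounded_integrable dk Kcompact (B := norm1 xi ^+ m)) => [|k Kk];
    [apply: measurableT_comp => //; apply/measurable_EFinP; case/integrableP: wi|
     rewrite normr_id ler_word_prod].
- apply: (haar_bounded_integrable dk Kcompact (B := norm1 xi ^+ m)) => // k _.
  by rewrite ger0_norm// exprn_ge0// norm1_ge0.
- by move=> k; exact: ler_word_prod.
Qed.

Lemma measurable_word_moment m (w : {ffun 'I_m -> 'I_n}) :
  measurable_fun setT (word_moment w).
Proof.
exact: (measurable_Rintegral_param dk mK (measurable_word_prod w)).
Qed.

(** The $P_{m,\xi}$ of the overview. All dependence on $\xi$ sits in the moments, so that
    integrating in $\xi$ will only change the coefficients. *)
Definition spherical_poly m xi : mpoly n R :=
  (m`!%:R)^-1 *: \sum_(w : {ffun 'I_m -> 'I_n})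
    word_moment w xi *: mpolyX R (word_mnm w).

Lemma peval_spherical_poly m xi x : peval (spherical_poly m xi) x =
  \int[dk]_(k in K) (dotp x (k *m xi) ^+ m / m`!%:R).
Proof.
rewrite /peval /spherical_poly linearZ/= linear_sum/=.
rewrite RintegralZr//; last first.
  apply: (haar_bounded_integrable dk Kcompact (B := (norm1 x * norm1 xi) ^+ m)).
    by apply: measurable_funTS; apply: measurable_funX; exact: measurable_dotp.
  move=> k Kk; rewrite normrX lerXn2r ?nnegrE ?mulr_ge0 ?norm1_ge0//.
  exact: ler_dotp_norm1.
rewrite mulrC; congr (_ * _).
under eq_Rintegral do rewrite /dotp exprn_sum_words.
rewrite Rintegral_sum//; last first.
  move=> w; rewrite (_ : _ \o _ = (fun k => (\prod_s x (w s) ord0)%:E *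
    (word_prod w xi k)%:E)%E).
    by apply: integrableZl => //; exact: word_prod_integrable.
  by apply/funext => k /=; rewrite EFinM.
apply: eq_bigr => w _; rewrite mevalZ meval_word mulrC RintegralZl//.
exact: word_prod_integrable.
Qed.

(** Moving [k0] across the scalar product turns it into [k0^T], again in [K], and left invariance of
    the Haar measure absorbs it. *)
Lemma spherical_poly_invariant m xi : invariant_poly K (spherical_poly m xi).
Proof.
move=> k0 x Kk0; rewrite !peval_spherical_poly.
have Kk0T := orthogonal_subgroup_tr Kgroup Kk0.
rewrite -(haar_left_invariant Kgroup Kcompact Khaar Kk0T
  (f := fun k => dotp x (k *m xi) ^+ m / m`!%:R)
  (B := (norm1 x * norm1 xi) ^+ m / m`!%:R)).
- apply: eq_Rintegral => k _; congr (_ ^+ _ / _).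
  by rewrite dotp_tr [RHS]dotp_tr !trmx_mul trmxK mulmxA.
- apply: measurable_funM => //; apply: measurable_funX; exact: measurable_dotp.
move=> k Kk; rewrite normrM normfV normr_nat ler_wpM2r ?invr_ge0//.
rewrite normrX lerXn2r ?nnegrE ?mulr_ge0 ?norm1_ge0//.
exact: ler_dotp_norm1.
Qed.

Lemma spherical_sym xi x : spherical K dk xi x = spherical K dk x xi.
Proof.
have sym (f : R -> R) : measurable_fun setT f -> (forall r, `|f r| <= 1) ->
    \int[dk]_(k in K) f (dotp x (k *m xi)) = \int[dk]_(k in K) f (dotp xi (k *m x)).
  move=> mf f1; rewrite -[RHS](haar_inv_invariant Kgroup Kcompact Khaar
      (f := fun k => f (dotp xi (k *m x))) (B := 1)).
  - by apply: eq_Rintegral => k _; rewrite dotp_tr.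
  - by apply: measurableT_comp mf _; exact: measurable_dotp.
  - by move=> k _.
rewrite /spherical /Cintegral /expi /=; congr (_ +i* _)%C.
  apply: sym => [|r]; last exact: cos_max.
  exact: (continuous_measurable_fun (@continuous_cos R)).
apply: sym => [|r]; last exact: sin_max.
exact: (continuous_measurable_fun (@continuous_sin R)).
Qed.

Section lift.
Variables (L : multinom n -> mpoly l R) (rho : l.-tuple (mpoly n R)).
Hypothesis Lbound : forall r : R, 0 <= r -> exists2 C, 0 <= C &
  forall a, wnorm (fun=> r) (L a) <= C ^+ mdeg a.
Hypothesis Llift : forall q, let f := comp_mpoly rho q in
  comp_mpoly rho (mlin L f) = f.
Hypothesis rhogen : generate_invariants K rho.

Definition lifted_poly m xi : mpoly l R := mlin L (spherical_poly m xi).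

Lemma lifted_polyE m xi : lifted_poly m xi =
  (m`!%:R)^-1 *: \sum_(w : {ffun 'I_m -> 'I_n}) word_moment w xi *: L (word_mnm w).
Proof.
rewrite /lifted_poly /spherical_poly linearZ/=; congr (_ *: _).
rewrite [LHS]linear_sum/=.
by apply: eq_bigr => w _; rewrite linearZ/= mlinX.
Qed.

Lemma peval_lifted_poly m xi x :
  peval (lifted_poly m xi) (peval_tuple rho x) = peval (spherical_poly m xi) x.
Proof.
have [_ /(_ _ (spherical_poly_invariant m xi))[q qE]] := rhogen.
have <- : comp_mpoly rho (lifted_poly m xi) = spherical_poly m xi.
  by rewrite /lifted_poly qE; exact: Llift.
rewrite /peval comp_mpoly_meval; apply: meval_eq => i.
by rewrite mxE.
Qed.

(** There are $n^m$ words, each contributing at most $A (BC)^m$, and $(nBC)^m/m!$ decays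
    geometrically. The coefficients are arbitrary because both the moments and their integrals
    against a test function are used. *)
Lemma wnorm_word_sum (r C A B : R) m (c : {ffun 'I_m -> 'I_n} -> R) : 0 <= r ->
  0 <= C -> 0 <= A -> 0 <= B -> (forall a, wnorm (fun=> r) (L a) <= C ^+ mdeg a) ->
  (forall w, `|c w| <= A * B ^+ m) ->
  wnorm (fun=> r) ((m`!%:R)^-1 *: \sum_w c w *: L (word_mnm w)) <=
  A * expR (2 * (n%:R * (B * C))) / 2 ^+ m.
Proof.
move=> r0 C0 A0 B0 LC cB; rewrite -mulrA.
apply: le_trans (ler_wpM2l A0 (ler_expR_geo m _)); last by rewrite !mulr_ge0.
rewrite wnormZ ger0_norm ?invr_ge0// [leLHS]mulrC [leRHS]mulrA ler_wpM2r ?invr_ge0//.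
rewrite (le_trans (ler_wnorm_sum _ _ _ _))//.
apply: (@le_trans _ _ (\sum_(w : {ffun 'I_m -> 'I_n}) A * (B * C) ^+ m)).
  apply: ler_sum => w _; rewrite wnormZ exprMn mulrA ler_pM ?wnorm_ge0//.
  by rewrite (le_trans (LC _))// mdeg_word.
rewrite sumr_const card_ffun !card_ord [in leRHS]exprMn -natrX.
by rewrite mulrCA mulr_natl.
Qed.

Lemma entire_lifted_poly (e : nat -> R) xi : (forall m, `|e m| <= 1) ->
  entire (fun m => e m *: lifted_poly m xi).
Proof.
move=> e1 r r0; have [C C0 LC] := Lbound r0.
exists (1 * expR (2 * (n%:R * (norm1 xi * C)))) => m.
rewrite wnormZ (@le_trans _ _ (wnorm (fun=> r) (lifted_poly m xi)))//.
  by rewrite ler_piMl// wnorm_ge0.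
rewrite lifted_polyE; apply: wnorm_word_sum => //; first exact: norm1_ge0.
by move=> w; rewrite mul1r; exact: ler_word_moment.
Qed.

End lift.

End SphericalExpansion.

(** * Integrals dominated by a constant on a box *)

Section Box.
Variables (R : realType) (n : nat).
Let mu := lebesgue_cV R n.

Definition box (b : R) : set 'cV[R]_n := [set x | forall i, `|x i ord0| <= b].

Lemma measurable_box b : measurable (box b).
Proof.
rewrite (_ : box b = \bigcap_(i in [set: 'I_n])
    ((fun x : 'cV[R]_n => `|x i ord0|) @^-1` `]-oo, b])).
  apply: fin_bigcap_measurable => // i _; rewrite -[X in measurable X]setTI.
  have mi : measurable_fun setT (fun x : 'cV[R]_n => `|x i ord0|).
    apply: (measurableT_comp (@normr_measurable R setT)).
    exact: measurable_coord_mx.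
  exact: mi.
apply/seteqP; split=> x /= h i; first by move=> _; rewrite /= in_itv/= h.
by have := h i I; rewrite /= in_itv.
Qed.

Lemma box_finite b : mu (box b) \is a fin_num.
Proof.
rewrite (_ : box b = [set x : 'cV[R]_n | forall i, `[- b, b]%classic (x i ord0)]).
  rewrite /mu (@lebesgue_cV_box R n (fun=> `[- b, b]%classic))//.
  elim/big_ind: _ => // [x y|i _]; first exact: fin_numM.
  by rewrite lebesgue_measure_itv; case: ifP.
by apply/seteqP; split=> x h i; move: (h i); rewrite /= in_itv/= ler_norml.
Qed.

Let dom_integrable (A b : R) : mu.-integrable setT (EFin \o (cst A \_ (box b))).
Proof.
rewrite -restrict_EFin; apply/(integrable_mkcond _ (measurable_box b)).
apply: measurable_bounded_integrable => //; first exact: measurable_box.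
  by rewrite -ge0_fin_numE// box_finite.
by exists `|A|; split; [exact: num_real|move=> M AM x _; exact: ltW].
Qed.

Lemma box_dominated_integrable (f : 'cV[R]_n -> R) (A b : R) :
  measurable_fun setT f -> (forall x, `|f x| <= (cst A \_ (box b)) x) ->
  mu.-integrable setT (EFin \o f).
Proof.
move=> mf fA.
by apply: (@dominated_integrable_EFin _ _ _ _ _ _ _ (cst A \_ (box b))).
Qed.

Lemma box_dominated_Rintegral (f : 'cV[R]_n -> R) (A b : R) :
  measurable_fun setT f -> (forall x, `|f x| <= (cst A \_ (box b)) x) ->
  `|\int[mu]_x f x| <= A * fine (mu (box b)).
Proof.
move=> mf fA; have fi := box_dominated_integrable mf fA.
rewrite (le_trans (le_normr_Rintegral _ _))//.
rewrite -Rintegral_cst; last exact: measurable_box.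
rewrite [leRHS]Rintegral_mkcond; apply: le_Rintegral => //.
  apply: (@box_dominated_integrable _ A b) => [|x]; last by rewrite normr_id.
  exact: measurableT_comp.
exact: dom_integrable.
Qed.

End Box.


(** * The functions $h_\xi$ and their integration against a test function *)

Section SphericalLift.
Import -(notations) mpoly.
Variables (R : realType) (n l : nat) (K : set 'M[R]_n).
Variable dk : probability 'M[R]_n R.
Hypotheses (Kgroup : orthogonal_subgroup K) (Kcompact : compact K).
Hypothesis Khaar : normalized_haar K dk.
Variables (L : multinom n -> mpoly l R) (rho : l.-tuple (mpoly n R)).
Hypothesis Lbound : forall r : R, 0 <= r -> exists2 C, 0 <= C &
  forall a, wnorm (fun=> r) (L a) <= C ^+ mdeg a.
Hypothesis Llift : forall q, let f := comp_mpoly rho q in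
  comp_mpoly rho (mlin L f) = f.
Hypothesis rhogen : generate_invariants K rho.
Implicit Types (xi x : 'cV[R]_n) (m : nat) (e : nat -> R).

Let mK : measurable K. Proof. exact: compact_measurable_mx. Qed.
Local Notation lifted_poly := (lifted_poly K dk L).
Local Notation word_moment := (word_moment K dk).
Local Notation mu := (lebesgue_cV R n).

Definition lifted_series e xi (t : 'cV[R]_l) : R :=
  polysum (fun m => e m *: lifted_poly m xi) t.

Lemma lifted_series_analytic e1 e2 xi :
  (forall m, `|e1 m| <= 1) -> (forall m, `|e2 m| <= 1) ->
  real_analytic (fun t => (lifted_series e1 xi t +i* lifted_series e2 xi t)%C).
Proof.
by move=> h1 h2; apply: entire_real_analytic;
   exact: (entire_lifted_poly Kgroup Kcompact Khaar Lbound).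
Qed.

(** The real and imaginary parts of $g(-\xi)h_\xi(t)$ mix the cosine and sine series; each becomes a
    single series here, ready for termwise integration. *)
Lemma lifted_series_comb e1 e2 (a c : R) xi t :
  (forall m, `|e1 m| <= 1) -> (forall m, `|e2 m| <= 1) ->
  a * lifted_series e1 xi t + c * lifted_series e2 xi t =
  limn (series (fun m => (a * e1 m + c * e2 m) * peval (lifted_poly m xi) t)).
Proof.
move=> e11 e21.
have entire_e e : (forall m, `|e m| <= 1) -> entire (fun m => e m *: lifted_poly m xi).
  exact: (entire_lifted_poly Kgroup Kcompact Khaar Lbound).
have [D1 h1] := entire_geo t (entire_e _ e11).
have [D2 h2] := entire_geo t (entire_e _ e21).
rewrite /lifted_series /polysum -(lim_geo_boundedZ a h1) -(lim_geo_boundedZ c h2).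
rewrite -(lim_geo_boundedD (geo_boundedZ a h1) (geo_boundedZ c h2)).
congr (limn (series _)); apply/funext => m.
by rewrite /peval !mevalZ mulrDl !mulrA.
Qed.

(** Termwise integration over [K], dominated because $|\langle x, k\xi\rangle|$ is at most the
    product of the l1 norms; the m-th integral is the value of an invariant polynomial, which the
    lift expresses in the generators. Cosine and sine are the two instances. *)
Lemma spherical_lift (f : R -> R) e xi x :
  (forall y, f y = limn (series (fun m => e m * (y ^+ m / m`!%:R)))) ->
  (forall m, `|e m| <= 1) ->
  \int[dk]_(k in K) f (dotp x (k *m xi)) =
  lifted_series e xi (peval_tuple rho x).
Proof.
move=> fE e1; under eq_Rintegral do rewrite fE.
pose X := norm1 x * norm1 xi.
have X0 : 0 <= X by rewrite mulr_ge0// norm1_ge0.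
pose u m (k : 'M[R]_n) := e m * (dotp x (k *m xi) ^+ m / m`!%:R).
have mdot m : measurable_fun setT (fun k : 'M[R]_n => dotp x (k *m xi) ^+ m / m`!%:R).
  by apply: measurable_funM => //; apply: measurable_funX; exact: measurable_dotp.
have dotB m k : K k -> `|dotp x (k *m xi) ^+ m / m`!%:R| <= expR (2 * X) / 2 ^+ m.
  move=> Kk; apply: le_trans (ler_expR_geo m X0).
  rewrite normrM normfV normr_nat ler_wpM2r ?invr_ge0// normrX.
  by rewrite lerXn2r ?nnegrE// (ler_dotp_norm1 Kgroup).
have [||| _ ->] := @integral_series _ _ _ dk K mK u (cst (expR (2 * X))).
- by move=> m; apply: measurable_funTS; apply: measurable_funM.
- apply: (haar_bounded_integrable dk Kcompact (B := expR (2 * X))) => // k _.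
  by rewrite ger0_norm// expR_ge0.
- move=> m k Kk; rewrite /u normrM; apply: le_trans (dotB m k Kk).
  by rewrite ler_piMl.
rewrite /lifted_series /polysum; congr (limn (series _)); apply/funext => m.
rewrite [RHS](_ : _ = e m * peval (lifted_poly m xi) (peval_tuple rho x)); last first.
  exact: mevalZ.
rewrite (peval_lifted_poly Kgroup Kcompact Khaar Llift rhogen).
rewrite (peval_spherical_poly dk Kgroup Kcompact) RintegralZl//.
by apply: (haar_bounded_integrable dk Kcompact) (dotB m); exact: measurable_funTS.
Qed.

Section integral.
Variables (g : nat -> 'cV[R]_n -> R) (A b : R).
Hypotheses (A0 : 0 <= A) (b0 : 0 <= b).
Hypothesis mg : forall m, measurable_fun setT (g m).
Hypothesis gA : forall m xi, `|g m xi| <= (cst A \_ (box b)) xi.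

(** The polynomial $\int g_m(\xi) Q_{m,\xi}\,d\xi$, integrated coefficient by coefficient. The
    factor [g] depends on [m] in order to carry the signs from $i^m$. *)
Definition integrated_poly m : mpoly l R := (m`!%:R)^-1 *:
  \sum_(w : {ffun 'I_m -> 'I_n}) (\int[mu]_xi (g m xi * word_moment w xi)) *:
    L (word_mnm w).

Let norm1_box xi : box b xi -> norm1 xi <= n%:R * b.
Proof.
move=> bxi; apply: (@le_trans _ _ (\sum_(j < n) b)); first exact: ler_sum.
by rewrite sumr_const card_ord mulr_natl.
Qed.

Let gmoment m (w : {ffun 'I_m -> 'I_n}) xi :
  `|g m xi * word_moment w xi| <= (cst (A * (n%:R * b) ^+ m) \_ (box b)) xi.
Proof.
rewrite normrM; have := gA m xi; rewrite !patchE.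
case: ifPn => [/set_mem bxi|_]; last first.
  by rewrite normr_le0 => /eqP ->; rewrite normr0 mul0r.
move=> gm; apply: ler_pM => //.
rewrite (le_trans (ler_word_moment Kgroup Kcompact Khaar _ _))//.
by rewrite lerXn2r ?nnegrE ?norm1_ge0 ?mulr_ge0// norm1_box.
Qed.

Let mgmoment m (w : {ffun 'I_m -> 'I_n}) :
  measurable_fun setT (fun xi => g m xi * word_moment w xi).
Proof. by apply: measurable_funM => //; exact: measurable_word_moment. Qed.

Lemma entire_integrated_poly : entire integrated_poly.
Proof.
move=> r r0; have [C C0 LC] := Lbound r0.
exists (A * fine (mu (box b)) * expR (2 * (n%:R * ((n%:R * b) * C)))) => m.
apply: wnorm_word_sum => //.
- by rewrite mulr_ge0// fine_ge0.
- by rewrite mulr_ge0.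
- move=> w; rewrite mulrAC; apply: box_dominated_Rintegral => //.
Qed.

Lemma integral_lifted_poly t :
  mu.-integrable setT (EFin \o (fun xi =>
    limn (series (fun m => g m xi * peval (lifted_poly m xi) t)))) /\
  \int[mu]_xi limn (series (fun m => g m xi * peval (lifted_poly m xi) t)) =
  polysum integrated_poly t.
Proof.
have r0 := norm1_ge0 t.
have [C C0 LC] := Lbound r0.
pose u m xi := g m xi * peval (lifted_poly m xi) t.
have uE m : u m = (fun xi => \sum_(w : {ffun 'I_m -> 'I_n})
    (g m xi * word_moment w xi) * ((m`!%:R)^-1 * peval (L (word_mnm w)) t)).
  apply/funext => xi; rewrite /u lifted_polyE /peval mevalZ linear_sum/= !mulr_sumr.
  by apply: eq_bigr => w _; rewrite mevalZ; ring.
have mu_ m : measurable_fun setT (u m).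
  rewrite uE; apply: measurable_sum => w.
  exact: measurable_funM.
(* On the box the l1 norm of [xi] is at most $nb$, so this bound is uniform in [xi]; outside the box
   [g m] vanishes. *)
pose E := A * expR (2 * (n%:R * ((n%:R * b) * C))).
have uB m xi : `|u m xi| <= (cst E \_ (box b)) xi / 2 ^+ m.
  rewrite /u normrM; have := gA m xi; rewrite !patchE.
  case: ifPn => [/set_mem bxi|_]; last first.
    by rewrite normr_le0 => /eqP ->; rewrite normr0 !mul0r.
  move=> gm; rewrite -mulrA; apply: ler_pM => //.
  apply: (@le_trans _ _ (wnorm (fun=> norm1 t) (lifted_poly m xi))).
    apply: ler_norm_meval => // i; rewrite /norm1 (bigD1 i)//= lerDl.
    exact: sumr_ge0.
  rewrite lifted_polyE -[leRHS]mul1r mulrA; apply: wnorm_word_sum => //.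
    by rewrite mulr_ge0.
  move=> w; rewrite mul1r (le_trans (ler_word_moment Kgroup Kcompact Khaar _ _))//.
  by rewrite lerXn2r ?nnegrE ?norm1_ge0 ?mulr_ge0// norm1_box.
have [|||iu ->] := @integral_series _ _ _ mu setT measurableT u (cst E \_ (box b)).
- exact: mu_.
- apply: (@box_dominated_integrable _ _ _ E b) => [|x].
    by apply/(measurable_restrictT _ (measurable_box b)).
  rewrite patchE; case: ifPn => _; rewrite ?normr0// ger0_norm//.
  by rewrite mulr_ge0// expR_ge0.
- by move=> m xi _; exact: uB.
split=> //; rewrite /polysum; congr (limn (series _)); apply/funext => m.
rewrite uE.
rewrite Rintegral_sum//; last first.
  move=> w; rewrite (_ : _ \o _ = (fun xi =>
    ((m`!%:R)^-1 * peval (L (word_mnm w)) t)%:E * (g m xi * word_moment w xi)%:E)%E).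
    apply: integrableZl => //; exact: box_dominated_integrable (gmoment w).
  by apply/funext => xi /=; rewrite EFinM muleC.
rewrite /peval /integrated_poly mevalZ linear_sum/= mulr_sumr.
apply: eq_bigr => w _; rewrite RintegralZr//.
  by rewrite mevalZ; ring.
exact: box_dominated_integrable (gmoment w).
Qed.

End integral.

End SphericalLift.

(** * Domination of compactly supported functions *)

Section CompactSupport.
Variables (R : realType) (n : nat).

Lemma continuous_compact_bound (S : set 'cV[R]_n) (f : 'cV[R]_n -> R) :
  compact S -> continuous f -> exists2 B, 0 <= B & forall x, S x -> `|f x| <= B.
Proof.
move=> cS cf.
have /compact_bounded[M [_ MP]] := continuous_compact (continuous_subspaceT cf) cS.
exists (`|M| + 1) => [|x Sx]; first by rewrite addr_ge0.
by apply: (MP (`|M| + 1)); [rewrite ltr_pwDr// ler_norm|exists x].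
Qed.

Lemma compactly_supported_box (g : 'cV[R]_n -> R[i]) :
  continuous (fun x => complex.Re (g x)) -> continuous (fun x => complex.Im (g x)) ->
  compactly_supported g -> exists (A b : R), [/\ 0 <= A, 0 <= b,
    forall x, `|complex.Re (g (- x))| <= (cst A \_ (box b)) x &
    forall x, `|complex.Im (g (- x))| <= (cst A \_ (box b)) x].
Proof.
move=> cr ci cg.
have [Ar Ar0 ArP] := continuous_compact_bound cg cr.
have [Ai Ai0 AiP] := continuous_compact_bound cg ci.
have bex (i : 'I_n) : exists B : R, 0 <= B /\
    forall x, closure [set x | g x != 0] x -> `|x i ord0| <= B.
  have [B B0 BP] := continuous_compact_bound cg (@coord_continuous R n 1 i ord0).
  by exists B.
have [b bP] := choice bex.
have gS x : g (- x) != 0 -> closure [set y | g y != 0] (- x).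
  by move=> gx; apply: (@subset_closure _ [set y | g y != 0]).
have inbox x : g (- x) != 0 -> x \in box (\sum_i b i).
  move=> gx; apply/mem_set => i; rewrite -normrN.
  have := (bP i).2 (- x) (gS _ gx); rewrite mxE => /le_trans; apply.
  by rewrite (bigD1 i)//= lerDl sumr_ge0// => j _; case: (bP j).
(* Sums serve as common upper bounds, of both parts of [g] and of all coordinates; the box is
   symmetric, so it also bounds the reflected support. *)
exists (Ar + Ai), (\sum_i b i); split.
- exact: addr_ge0.
- by apply: sumr_ge0 => i _; case: (bP i).
- move=> x; rewrite patchE; have [gx|/[dup] gx /inbox ->] := eqVneq (g (- x)) 0.
    by rewrite gx /= normr0; case: ifP => // _; exact: addr_ge0.
  by rewrite (le_trans (ArP _ (gS _ gx)))//= lerDl.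
- move=> x; rewrite patchE; have [gx|/[dup] gx /inbox ->] := eqVneq (g (- x)) 0.
    by rewrite gx /= normr0; case: ifP => // _; exact: addr_ge0.
  by rewrite (le_trans (AiP _ (gS _ gx)))//= lerDr.
Qed.

End CompactSupport.

(** * The Gelfand transform as a smooth function of the generators *)

Theorem corollary1p4 (R : realType) (n l : nat) (K : set 'M[R]_n)
    (dk : probability 'M[R]_n R) (rho : l.-tuple (mpoly.mpoly n R)) :
  orthogonal_subgroup K -> compact K -> normalized_haar K dk ->
  generate_invariants K rho ->
  exists h_ : 'cV[R]_n -> 'cV[R]_l -> R[i],
    [/\ forall xi, real_analytic (h_ xi),
        forall xi x, spherical K dk xi x = h_ xi (peval_tuple rho x) &
        forall g : 'cV[R]_n -> R[i],
          invariant_fun K g -> Csmooth g -> compactly_supported g ->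
          let h t := Cintegral (@lebesgue_cV R n) setT
                       (fun xi => g (- xi) * h_ xi t) in
          [/\ forall t, Cintegrable (@lebesgue_cV R n) setT
                          (fun xi => g (- xi) * h_ xi t),
              Csmooth h &
              forall xi, gelfand_transform g (spherical K dk xi) =
                         h (peval_tuple rho xi)]].
Proof.
move=> Kgroup Kcompact Khaar rhogen.
have [L [Lbound Llift]] := bounded_lift rho.
pose p m xi := lifted_poly K dk L m xi.
pose h_ (xi : 'cV[R]_n) (t : 'cV[R]_l) : R[i] :=
  (lifted_series K dk L (cos_sign R) xi t +i*
   lifted_series K dk L (sin_sign R) xi t)%C.
have comb := lifted_series_comb Kgroup Kcompact Khaar Lbound.
have spherical_h xi x : spherical K dk xi x = h_ xi (peval_tuple rho x).
  rewrite /spherical /Cintegral /expi /h_ /=; congr (_ +i* _)%C.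
    apply: (spherical_lift Kgroup Kcompact Khaar Llift rhogen).
      exact: cos_sign_series.
    exact: cos_sign_le1.
  apply: (spherical_lift Kgroup Kcompact Khaar Llift rhogen).
    exact: sin_sign_series.
  exact: sin_sign_le1.
exists h_; split=> [xi|//|g _ gsmooth gsupp h].
  apply: (lifted_series_analytic Kgroup Kcompact Khaar Lbound).
    exact: cos_sign_le1.
  exact: sin_sign_le1.
have [[cr _] [ci _]] := gsmooth 0%N.
have [A [b [A0 b0 gr gi]]] := compactly_supported_box cr ci gsupp.
(* [gre] and [gim] are the real and imaginary parts of $i^m g(-\xi)$. *)
pose gre m (xi : 'cV[R]_n) := complex.Re (g (- xi)) * cos_sign R m +
  - complex.Im (g (- xi)) * sin_sign R m.
pose gim m (xi : 'cV[R]_n) := complex.Re (g (- xi)) * sin_sign R m +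
  complex.Im (g (- xi)) * cos_sign R m.
have mr : measurable_fun setT (fun xi : 'cV[R]_n => complex.Re (g (- xi))).
  apply: (measurableT_comp (continuous_measurable_mx cr)).
  exact: measurable_oppmx.
have mi : measurable_fun setT (fun xi : 'cV[R]_n => complex.Im (g (- xi))).
  apply: (measurableT_comp (continuous_measurable_mx ci)).
  exact: measurable_oppmx.
have comb_le (u v c s : R) xi : `|c| <= 1 -> `|s| <= 1 ->
    `|u| <= (cst A \_ (box b)) xi -> `|v| <= (cst A \_ (box b)) xi ->
    `|u * c + v * s| <= (cst (A + A) \_ (box b)) xi.
  move=> c1 s1; rewrite !patchE; case: ifP => _ /= uA vA.
    rewrite (le_trans (ler_normD _ _))// !normrM lerD//.
      by rewrite (le_trans _ uA)// ler_piMr.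
    by rewrite (le_trans _ vA)// ler_piMr.
  move: uA vA; rewrite !normr_le0 => /eqP -> /eqP ->.
  by rewrite !mul0r addr0.
have AA0 : 0 <= A + A by exact: addr_ge0.
have gre_le m xi : `|gre m xi| <= (cst (A + A) \_ (box b)) xi.
  by apply: comb_le; rewrite ?cos_sign_le1 ?sin_sign_le1 ?normrN.
have gim_le m xi : `|gim m xi| <= (cst (A + A) \_ (box b)) xi.
  by apply: comb_le; rewrite ?cos_sign_le1 ?sin_sign_le1.
have mgre m : measurable_fun setT (gre m).
  apply: measurable_funD; apply: measurable_funM => //.
  exact: measurableT_comp (@oppr_measurable R setT) mi.
have mgim m : measurable_fun setT (gim m).
  by apply: measurable_funD; apply: measurable_funM.
have Re_gh t : (fun xi => complex.Re (g (- xi) * h_ xi t)) =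
    (fun xi => limn (series (fun m => gre m xi * peval (p m xi) t))).
  apply/funext => xi; rewrite -comb ?mulNr;
    [|exact: cos_sign_le1|exact: sin_sign_le1].
  by rewrite /h_; case: (g _).
have Im_gh t : (fun xi => complex.Im (g (- xi) * h_ xi t)) =
    (fun xi => limn (series (fun m => gim m xi * peval (p m xi) t))).
  apply/funext => xi; rewrite -comb;
    [|exact: sin_sign_le1|exact: cos_sign_le1].
  by rewrite /h_; case: (g _).
have intRe t := integral_lifted_poly Kgroup Kcompact Khaar Lbound AA0 b0 mgre gre_le t.
have intIm t := integral_lifted_poly Kgroup Kcompact Khaar Lbound AA0 b0 mgim gim_le t.
have entire_int := entire_integrated_poly Kgroup Kcompact Khaar Lbound AA0 b0.
have hint t : Cintegrable (lebesgue_cV R n) setT (fun xi => g (- xi) * h_ xi t).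
  split.
    rewrite -[X in _.-integrable _ X]/(EFin \o
      (fun xi => complex.Re (g (- xi) * h_ xi t))).
    by rewrite Re_gh; exact: (intRe t).1.
  rewrite -[X in _.-integrable _ X]/(EFin \o
    (fun xi => complex.Im (g (- xi) * h_ xi t))).
  by rewrite Im_gh; exact: (intIm t).1.
split=> //.
  move=> k; split.
    rewrite (_ : (fun t => _) = polysum (integrated_poly K dk L gre)).
      by apply: entire_Ck; exact: entire_int.
    by apply/funext => t; rewrite /h /Cintegral /= Re_gh; exact: (intRe t).2.
  rewrite (_ : (fun t => _) = polysum (integrated_poly K dk L gim)).
    by apply: entire_Ck; exact: entire_int.
  by apply/funext => t; rewrite /h /Cintegral /= Im_gh; exact: (intIm t).2.
move=> xi; have [ir ii] := hint (peval_tuple rho xi).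
(* Reflection turns the integrand of [h] into $g(x)\varphi_{-x}(\xi)$, which the symmetry of the
   spherical functions identifies with $g(x)\varphi_\xi(-x)$. *)
rewrite /gelfand_transform /h /Cintegral; congr (_ +i* _)%C.
  rewrite -[RHS]Rintegral_opp//; last first.
    by apply/measurable_EFinP; exact: measurable_int ir.
  apply: eq_Rintegral => x _; rewrite opprK -spherical_h.
  by rewrite (spherical_sym Kgroup Kcompact Khaar).
rewrite -[RHS]Rintegral_opp//; last first.
  by apply/measurable_EFinP; exact: measurable_int ii.
apply: eq_Rintegral => x _; rewrite opprK -spherical_h.
by rewrite (spherical_sym Kgroup Kcompact Khaar).
Qed.
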